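(* Let $q\ge2$ be an integer. For every integer $s\ge 2$ there exist constants $\kappa_s>0$ and $C>0$ (depending only on $q$ and $s$) such that for every $q$-multiplicative sequence $f\colon\mathbb{N}_0\to\mathbb{U}$ and every integer $N\ge1$, $$\|f\|_{U^s[N]}\le C\,\|f\|_{U^2[N]}^{\kappa_s}.$$
   Context: $\mathbb{N}_0=\{0,1,2,\dots\}$, $\mathbb{U}=\{z\in\mathbb{C}:|z|=1\}$. A sequence $f\colon\mathbb{N}_0\to\mathbb{U}$ is $q$-multiplicative if for all integers $t,m,n\ge 0$ with $m<q^t$ and $q^t\mid n$ one has $f(m+n)=f(m)f(n)$. For $N\ge1$ let $[N]=\{0,1,\dots,N-1\}$. For $s\ge1$ let $\Pi(N)$ be the set of $\vec n=(n_0,\dots,n_s)\in\mathbb{Z}^{s+1}$ such that $n_0+\omega_1n_1+\dots+\omega_sn_s\in[N]$ for all $\omega\in\{0,1\}^s$. The Gowers uniformity norm $\|f\|_{U^s[N]}\ge0$ is defined by $$\|f\|_{U^s[N]}^{2^s}=\frac{1}{|\Pi(N)|}\sum_{\vec n\in\Pi(N)}\prod_{\omega\in\{0,1\}^s}\mathcal{C}^{|\omega|}f(n_0+\omega_1n_1+\dots+\omega_sn_s),$$ where $\mathcal{C}$ denotes complex conjugation and $|\omega|=\omega_1+\dots+\omega_s$. *)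

(* Defs.v *)
From HB Require Import structures.
From mathcomp Require Import all_boot all_order all_algebra.
From mathcomp Require Import all_classical all_reals all_analysis.
From mathcomp Require Import complex.
Set Implicit Arguments. Unset Strict Implicit. Unset Printing Implicit Defensive.
Import Order.TTheory GRing.Theory Num.Theory.
Local Open Scope ring_scope.

Definition unimodular (R : rcfType) (f : nat -> R[i]) : Prop :=
  forall n, `|f n| = 1.

Definition q_multiplicative (R : rcfType) (q : nat) (f : nat -> R[i]) : Prop :=
  forall t m n : nat, (m < q ^ t)%N -> (q ^ t %| n)%N -> f (m + n)%N = f m * f n.

(* Parameters of Pi(N): n_0 ranges over [N] (every element of Pi(N) has
   n_0 = n_0 + 0*n_1+... in [N]); n_i (i=1..s) is encoded by k : 'I_(2N)
   as k - N, which covers [-N, N), containing every possible n_i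
   (since n_0, n_0 + n_i are both in [N]). *)
Definition cube_point (s N : nat) (n0 : 'I_N) (h : {ffun 'I_s -> 'I_(2 * N)})
  (w : {ffun 'I_s -> bool}) : int :=
  (n0%:Z + \sum_(i < s | w i) ((h i)%:Z - N%:Z))%R.

Definition in_Pi (s N : nat) (n0 : 'I_N) (h : {ffun 'I_s -> 'I_(2 * N)}) : bool :=
  [forall w : {ffun 'I_s -> bool},
     (0 <= cube_point n0 h w)%R && (cube_point n0 h w < N%:Z)%R].

Definition card_Pi (s N : nat) : nat :=
  \sum_(n0 : 'I_N) \sum_(h : {ffun 'I_s -> 'I_(2 * N)} | in_Pi n0 h) 1%N.

Definition conj_pow (R : rcfType) (k : nat) (z : R[i]) : R[i] :=
  if odd k then conjc z else z.

Definition gowers_pow (R : rcfType) (s N : nat) (f : nat -> R[i]) : R[i] :=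
  (card_Pi s N)%:R^-1 *
  \sum_(n0 : 'I_N) \sum_(h : {ffun 'I_s -> 'I_(2 * N)} | in_Pi n0 h)
     \prod_(w : {ffun 'I_s -> bool})
        conj_pow #|[pred i | w i]| (f (absz (cube_point n0 h w))).

(* ||f||_{U^s[N]} : the nonnegative 2^s-th root of the above
   (which is a nonnegative real number; we take its real part). *)
Definition gowers_norm (R : realType) (s N : nat) (f : nat -> R[i]) : R :=
  powR (complex.Re (gowers_pow s N f)) (2 ^+ s)^-1.

(* Main.v *)
(* Let [D_s g] be the [s]-fold multiplicative difference of [g], all steps being
   [1], and let [sigma_t] measure the distance to [1] of the first values of
   [D_s g_t], where [g_t n = f (q ^ t * n)].

   Upper bound: expanding in base [q], the Gowers average of order [s] is a
   product of transfer operators acting on functions of the carries. A bounded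
   block of digits starting at [t] contracts the sup norm by a factor
   [exp (- c * sigma_t ^ 2)], because two choices of digits lead to the same
   carries with phases in ratio [D_s g_t]. Hence
   [U^s <= C * exp (- c * sum_t sigma_t ^ 2)].

   Degree descent: multiplicativity across a digit boundary kills mixed
   differences, so if [g_t] is nearly a polynomial phase of degree [d >= 2],
   then [g_(t + 1)] is nearly one of degree [d - 1]. Thus [g_(t + s - 2)] is
   linear up to [O(sigma_t)].

   Lower bound: choose the frequency digit by digit from the top, taking the
   [q]-th root nearest to the local slope, or merely a root with a large digit
   sum when [f] is far from linear at that digit. The slope errors contract
   geometrically, and [f] correlates with a linear phase by at least
   [c * exp (- C * sum_t sigma_t ^ 2)]; so does [U^2], up to a power. *)
Require Import Defs.
From HB Require Import structures.
From mathcomp Require Import all_boot all_order all_algebra.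
From mathcomp Require Import all_classical all_reals all_analysis.
From mathcomp Require Import complex.
From mathcomp Require Import ring lra zify.
Import Order.TTheory GRing.Theory Num.Theory.
Local Open Scope ring_scope.
Set Implicit Arguments. Unset Strict Implicit. Unset Printing Implicit Defensive.

(** * Moduli of complex numbers *)

Definition cabs (R : rcfType) (z : R[i]) : R := Normc.normc z.

Section ComplexModulus.
Variable R : realType.
Implicit Types (z w : R[i]).

Lemma cabsE z : `|z| = (cabs z)%:C%C.
Proof. by []. Qed.

Lemma cabs_ge0 z : 0 <= cabs z.
Proof. by case: z => a b; rewrite /cabs /= sqrtr_ge0. Qed.

Lemma cabs0 : cabs (0 : R[i]) = 0.
Proof. exact: Normc.normc0. Qed.

Lemma cabs1 : cabs (1 : R[i]) = 1.
Proof. exact: Normc.normc1. Qed.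

Lemma cabsM z w : cabs (z * w) = cabs z * cabs w.
Proof. exact: Normc.normcM. Qed.

Lemma cabs_le_add z w : cabs (z + w) <= cabs z + cabs w.
Proof.
have : `|z + w| <= `|z| + `|w| by exact: ler_normD.
by rewrite !cabsE -rmorphD /= lecR.
Qed.

Lemma cabsN z : cabs (- z) = cabs z.
Proof. by case: z => a b; rewrite /cabs /= !sqrrN. Qed.

Lemma cabs_distC z w : cabs (z - w) = cabs (w - z).
Proof. by rewrite -cabsN opprB. Qed.

Lemma cabs_conj z : cabs (conjc z) = cabs z.
Proof. by case: z => a b; rewrite /cabs /= sqrrN. Qed.

Lemma cabs_conj_pow k z : cabs (conj_pow k z) = cabs z.
Proof. by rewrite /conj_pow; case: odd; rewrite ?cabs_conj. Qed.

Lemma cabs_nat n : cabs (n%:R : R[i]) = n%:R.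
Proof.
elim: n => [|n IHn]; first exact: cabs0.
by rewrite -(rmorph_nat (@real_complex R)) /cabs /= expr0n addr0 sqrtr_sqr ger0_norm.
Qed.

Lemma cabsX z n : cabs (z ^+ n) = cabs z ^+ n.
Proof. by elim: n => [|n IHn]; rewrite ?cabs1 // !exprS cabsM IHn. Qed.

Lemma cabsV z : cabs (z^-1) = (cabs z)^-1.
Proof. exact: Normc.normcV. Qed.

Lemma cabs_prod (I : Type) (r : seq I) (P : pred I) (F : I -> R[i]) :
  cabs (\prod_(i <- r | P i) F i) = \prod_(i <- r | P i) cabs (F i).
Proof. exact: (big_morph _ cabsM cabs1). Qed.

Lemma cabs_sum_le (I : Type) (r : seq I) (P : pred I) (F : I -> R[i]) :
  cabs (\sum_(i <- r | P i) F i) <= \sum_(i <- r | P i) cabs (F i).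
Proof.
elim/big_rec2: _ => [|i y z _ le_yz]; first by rewrite cabs0.
by apply: le_trans (cabs_le_add _ _) _; rewrite lerD2l.
Qed.

Lemma cabs_dist z w t : cabs (z - t) <= cabs (z - w) + cabs (w - t).
Proof. by have := cabs_le_add (z - w) (w - t); rewrite addrA subrK. Qed.

Lemma cabs_rev z w : cabs z <= cabs w + cabs (z - w).
Proof. by have := cabs_le_add w (z - w); rewrite addrC subrK. Qed.

Lemma mul_conjc z : z * conjc z = (cabs z ^+ 2)%:C%C.
Proof. by rewrite -sqr_normc cabsE rmorphXn. Qed.

Lemma sqr_cabs z : cabs z ^+ 2 = complex.Re z ^+ 2 + complex.Im z ^+ 2.
Proof.
by case: z => a b; rewrite /cabs /= sqr_sqrtr // addr_ge0 // sqr_ge0.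
Qed.

Lemma Re_le_cabs z : complex.Re z <= cabs z.
Proof.
case: z => a b; rewrite /cabs /=; apply: le_trans (ler_norm a) _.
by rewrite -sqrtr_sqr ler_wsqrtr // lerDl sqr_ge0.
Qed.

Lemma unimodularP (f : nat -> R[i]) n : unimodular f -> cabs (f n) = 1.
Proof. by move/(_ n); rewrite cabsE => -[]. Qed.

Lemma unimodular_conj z : cabs z = 1 -> z * conjc z = 1.
Proof. by move=> z1; rewrite mul_conjc z1 expr1n. Qed.

Lemma Re_unimodular z : cabs z = 1 ->
  complex.Re z = 1 - cabs (1 - z) ^+ 2 / 2.
Proof.
move=> z1; have := sqr_cabs z; rewrite z1 sqr_cabs; case: z {z1} => a b /=.
by rewrite expr1n => h; lra.
Qed.

Lemma parallelogram1 z : cabs z = 1 ->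
  cabs (1 + z) ^+ 2 = 4 - cabs (1 - z) ^+ 2.
Proof.
move=> z1; have := sqr_cabs z; rewrite z1 !sqr_cabs; case: z {z1} => a b /=.
by rewrite expr1n => h; lra.
Qed.

Lemma cabs_1B_le2 z : cabs z = 1 -> cabs (1 - z) <= 2.
Proof.
by move=> z1; apply: le_trans (cabs_le_add _ _) _; rewrite cabsN cabs1 z1.
Qed.

Lemma cabs_1BM z w : cabs z = 1 ->
  cabs (1 - z * w) <= cabs (1 - z) + cabs (1 - w).
Proof.
move=> z1; have -> : 1 - z * w = (1 - z) + z * (1 - w) by ring.
by apply: le_trans (cabs_le_add _ _) _; rewrite cabsM z1 mul1r.
Qed.

Lemma cabs_1B_conj z : cabs (1 - conjc z) = cabs (1 - z).
Proof. by rewrite -cabs_conj rmorphB rmorph1 /= conjcK. Qed.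

End ComplexModulus.

(** * Iterated multiplicative differences *)

(** The conjugate falls on the shifted factor, as in the Gowers product; see [cube_diff]. *)
Definition mdiff (R : rcfType) (h : nat) (u : nat -> R[i]) (n : nat) : R[i] :=
  u n * conjc (u (n + h)%N).

Definition dilate (R : rcfType) (k : nat) (u : nat -> R[i]) (n : nat) : R[i] :=
  u (k * n)%N.

Section Differences.
Variable R : realType.
Implicit Types (u v g f : nat -> R[i]).

Local Notation unim u := (forall n, cabs (u n) = 1).

Lemma mdiff_unim h u : unim u -> unim (mdiff h u).
Proof. by move=> u1 n; rewrite /mdiff cabsM cabs_conj !u1 mulr1. Qed.

Lemma iter_mdiff_unim h d u : unim u -> unim (iter d (mdiff h) u).
Proof. by move=> u1; elim: d => //= d IHd; exact: mdiff_unim. Qed.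

Lemma mdiffC h k u : mdiff h (mdiff k u) = mdiff k (mdiff h u).
Proof.
apply/funext => n; rewrite /mdiff !rmorphM /= -!addnA (addnC k h).
by ring.
Qed.

Lemma iter_mdiffC h k d u :
  mdiff h (iter d (mdiff k) u) = iter d (mdiff k) (mdiff h u).
Proof. by elim: d => //= d <-; rewrite mdiffC. Qed.

Lemma mdiffSr k u n : unim u ->
  mdiff k.+1 u n = mdiff k u n * mdiff 1 u (n + k)%N.
Proof.
move=> u1; rewrite /mdiff -addnA addn1.
have := unimodular_conj (u1 (n + k)%N); set a := u (n + k)%N => h.
rewrite -[LHS]mulr1 -h; ring.
Qed.

Lemma cabs_1B_mdiff k u n : unim u ->
  cabs (1 - mdiff k u n) <= \sum_(j < k) cabs (1 - mdiff 1 u (n + j)%N).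
Proof.
move=> u1; elim: k => [|k IHk].
  by rewrite big_ord0 /mdiff addn0 unimodular_conj // subrr cabs0.
rewrite big_ord_recr /= mdiffSr //.
apply: le_trans (cabs_1BM _ _) _; first exact: mdiff_unim.
by rewrite lerD2r.
Qed.

(** A difference of step [q] is a product of [q] differences of step [1], so each of the [e]
    differences costs a factor [q] and [q] further points. *)
Lemma cabs_1B_iter_mdiff q e M eps u : unim u ->
  (forall n, (n < M + e * q)%N -> cabs (1 - iter e (mdiff 1) u n) <= eps) ->
  forall n, (n < M)%N -> cabs (1 - iter e (mdiff q) u n) <= q%:R ^+ e * eps.
Proof.
elim: e u M => [|e IHe] u M u1 small n ltnM /=.
  by rewrite mul1r small // mul0n addn0.
rewrite exprS -mulrA.
apply: le_trans (cabs_1B_mdiff _ _ (iter_mdiff_unim _ _ u1)) _.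
have := IHe (mdiff 1 u) (M + q)%N (mdiff_unim _ u1).
rewrite -iterSr -iter_mdiffC => small'.
have -> : q%:R * (q%:R ^+ e * eps) = \sum_(j < q) (q%:R ^+ e * eps).
  by rewrite sumr_const card_ord mulr_natl.
apply: ler_sum => j _; apply: small' => [m ltm|]; last first.
  by have := ltn_ord j; lia.
by apply: small; rewrite mulSn addnA.
Qed.

Lemma iter_mdiff_dilate q d u :
  iter d (mdiff 1) (dilate q u) = dilate q (iter d (mdiff q) u).
Proof.
elim: d => //= d ->; apply/funext => n.
by rewrite /mdiff /dilate mulnDr muln1.
Qed.

Lemma iter_mdiff_multiples q e w (c : R[i]) : cabs c = 1 ->
  (forall b, w (q * b)%N = c) ->
  forall b, iter e.+1 (mdiff q) w (q * b)%N = 1.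
Proof.
move=> c1 wc; elim: e => [|e IHe] b.
  by rewrite /= /mdiff -mulnSr !wc unimodular_conj.
rewrite iterS /mdiff -mulnSr !IHe rmorph1 mulr1 //.
Qed.

(* A phase that is multiplicative across a digit boundary has
   [mdiff 1 g] constant on multiples of [q], which kills one more difference
   of step [q]; this lowers the degree by one when passing to [g (q * _)]. *)
Lemma degree_descent q e M eps g : unim g -> (1 < q)%N ->
  (forall a b, (a < q)%N -> g (a + q * b)%N = g a * g (q * b)%N) ->
  (forall n, (n < q * M + e.+1 * q)%N ->
     cabs (1 - iter e.+3 (mdiff 1) g n) <= eps) ->
  forall b, (b < M)%N ->
    cabs (1 - iter e.+2 (mdiff 1) (dilate q g) b) <= q%:R ^+ e.+3 * eps.
Proof.
move=> g1 q1 gM small b ltbM.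
rewrite iter_mdiff_dilate /dilate iterS.
set v := iter e.+1 (mdiff q) g.
have v1 : unim v by exact: iter_mdiff_unim.
(* Differences of steps [1] and [q] commute, and [mdiff 1 g] equals [conjc (g 1)] at every multiple
   of [q]. *)
have Dv c : mdiff 1 v (q * c)%N = 1.
  rewrite /v iter_mdiffC; apply: (@iter_mdiff_multiples _ _ _ (conjc (g 1%N))).
    by rewrite cabs_conj.
  move=> c'; rewrite /mdiff addnC gM // rmorphM /=.
  by rewrite mulrCA unimodular_conj // mulr1.
have D2v n : (n < q * M)%N -> cabs (1 - mdiff 1 (mdiff 1 v) n) <= q%:R ^+ e.+1 * eps.
  rewrite /v !iter_mdiffC; apply: cabs_1B_iter_mdiff.
    by do 2!apply: mdiff_unim.
  by move=> m ltm; rewrite -!iterSr; exact: small.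
have q0 : 0 <= q%:R ^+ e.+1 * eps.
  by apply: le_trans (D2v 0%N _); rewrite ?cabs_ge0 // muln_gt0; lia.
apply: le_trans (cabs_1B_mdiff _ _ v1) _.
have -> : q%:R ^+ e.+3 * eps = \sum_(j < q) \sum_(i < q) (q%:R ^+ e.+1 * eps).
  by rewrite !sumr_const card_ord -mulrnA exprS [in LHS]exprS -!mulrA mulrA -natrM mulr_natl.
apply: ler_sum => j _.
(* The value at [q * b + j] is compared with the value [1] at [q * b]; this brings in second
   differences of [v], which [D2v] controls. *)
have -> : cabs (1 - mdiff 1 v (q * b + j)%N) = cabs (1 - mdiff j (mdiff 1 v) (q * b)%N).
  rewrite [RHS](_ : _ = cabs (1 - mdiff 1 v (q * b)%N * conjc (mdiff 1 v (q * b + j)%N))) //.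
  by rewrite Dv mul1r cabs_1B_conj.
apply: le_trans (cabs_1B_mdiff _ _ (mdiff_unim _ v1)) _.
have lt_bM : (q * b + q <= q * M)%N by rewrite -mulnSr leq_mul2l ltbM orbT.
apply: (@le_trans _ _ (\sum_(i < j) (q%:R ^+ e.+1 * eps))).
  apply: ler_sum => i _; apply: D2v.
  by have := ltn_ord i; have := ltn_ord j; lia.
rewrite !sumr_const !card_ord ler_wpMn2l //; exact: ltnW.
Qed.

Lemma unimodular_unim f : unimodular f -> unim f.
Proof. by move=> f1 n; exact: unimodularP. Qed.

Lemma dilateM k l u : dilate k (dilate l u) = dilate (l * k)%N u.
Proof. by apply/funext => n; rewrite /dilate mulnA. Qed.

Lemma q_mult_dilate q f t k a b : (0 < q)%N -> q_multiplicative q f ->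
  (a < q ^ k)%N ->
  dilate (q ^ t) f (a + q ^ k * b)%N =
  dilate (q ^ t) f a * dilate (q ^ t) f (q ^ k * b)%N.
Proof.
move=> q0 fM lta; rewrite /dilate mulnDr (fM (t + k)%N) //.
  by rewrite expnD ltn_pmul2l // expn_gt0 q0.
by rewrite expnD mulnA dvdn_mulr.
Qed.

Lemma q_mult0 q f : unimodular f -> q_multiplicative q f -> f 0%N = 1.
Proof.
move=> /unimodular_unim f1 /(_ 0%N 0%N 0%N); rewrite expn0 /= => /(_ isT isT).
have f0 : f 0%N != 0.
  by apply/eqP => f0; have := f1 0%N; rewrite f0 cabs0 => /eqP; rewrite eq_sym oner_eq0.
by rewrite addn0 -{1}[f 0%N]mulr1 => /(mulfI f0).
Qed.

(** Each descent raises [t] by one and lowers the degree by one. The window and the loss are fixed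
    before [f] and [t], so the bound is uniform in both. *)
Lemma degree_descent_to2 q e M : (1 < q)%N -> exists M' C : nat,
  forall f t (eps : R), unimodular f -> q_multiplicative q f ->
  (forall n, (n < M')%N ->
     cabs (1 - iter e.+2 (mdiff 1) (dilate (q ^ t) f) n) <= eps) ->
  forall n, (n < M)%N ->
    cabs (1 - iter 2 (mdiff 1) (dilate (q ^ (t + e)) f) n) <= C%:R * eps.
Proof.
move=> q1; elim: e => [|e [M' [C IHe]]].
  by exists M, 1%N => f t eps f1 fM small n ltn; rewrite addn0 mul1r small.
exists (q * M' + e.+1 * q)%N, (C * q ^ e.+3)%N => f t eps f1 fM small n ltn.
rewrite natrM natrX -mulrA addnS -addSn; apply: IHe ltn => // m ltm.
rewrite expnSr -dilateM; apply: degree_descent ltm => //.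
  by move=> k; rewrite /dilate; exact: unimodular_unim.
by move=> a b lta; have := @q_mult_dilate q f t 1 a b (ltnW q1) fM; rewrite expn1; apply.
Qed.

End Differences.

(** * Digits, carries and transfer operators *)

Definition fcons (T : Type) (s : nat) (x : T) (w : {ffun 'I_s -> T}) :
  {ffun 'I_s.+1 -> T} := [ffun i => if unlift ord0 i is Some j then w j else x].

Lemma fcons0 (T : Type) (s : nat) (x : T) (w : {ffun 'I_s -> T}) :
  fcons x w ord0 = x.
Proof. by rewrite ffunE unlift_none. Qed.

Lemma fconsS (T : Type) (s : nat) (x : T) (w : {ffun 'I_s -> T}) i :
  fcons x w (lift ord0 i) = w i.
Proof. by rewrite ffunE liftK. Qed.

Lemma big_fcons (V : Type) (idx : V) (op : Monoid.com_law idx) (T : finType)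
  (s : nat) (F : {ffun 'I_s.+1 -> T} -> V) :
  \big[op/idx]_w F w = \big[op/idx]_(x : T) \big[op/idx]_w F (fcons x w).
Proof.
rewrite pair_big /=.
rewrite (reindex (fun p : T * {ffun 'I_s -> T} => fcons p.1 p.2)) //=.
exists (fun w => (w ord0, [ffun i => w (lift ord0 i)])) => [[x w]|w] _ /=.
  rewrite fcons0; congr (_, _); apply/ffunP => i.
  by rewrite ffunE fconsS.
apply/ffunP => i; rewrite ffunE; case: unliftP => [j|] -> //.
by rewrite ffunE.
Qed.

Lemma sum_fcons (V : nmodType) (s : nat) (x : bool) (w : {ffun 'I_s -> bool})
  (F : 'I_s.+1 -> V) :
  \sum_(i | fcons x w i) F i = F ord0 *+ x + \sum_(i | w i) F (lift ord0 i).
Proof.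
rewrite big_mkcond big_ord_recl fcons0 [in RHS]big_mkcond.
congr (_ + _); first by case: x.
by apply: eq_bigr => i _; rewrite fconsS.
Qed.

Definition weight (s : nat) (w : {ffun 'I_s -> bool}) : nat := #|[pred i | w i]|.

Lemma weightE s (w : {ffun 'I_s -> bool}) : weight w = (\sum_(i | w i) 1)%N.
Proof. by rewrite /weight -sum1_card. Qed.

Lemma weight_le s (w : {ffun 'I_s -> bool}) : (weight w <= s)%N.
Proof. by rewrite -[leqRHS](card_ord s) max_card. Qed.

Lemma weight_fcons s x (w : {ffun 'I_s -> bool}) :
  weight (fcons x w) = (x + weight w)%N.
Proof.
by rewrite !weightE (@sum_fcons nat); case: x.
Qed.

Lemma big_digit (V : nmodType) Q a (F : nat -> V) :
  \sum_(x < Q * a) F x = \sum_(k < a) \sum_(m < Q) F (Q * k + m)%N.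
Proof.
elim: a => [|a IHa]; first by rewrite muln0 !big_ord0.
by rewrite mulnSr big_split_ord big_ord_recr /= IHa.
Qed.

Lemma digit_lt Q b (k : 'I_b) (m : 'I_Q) : (Q * k + m < Q * b)%N.
Proof.
apply: (@leq_trans (Q * k.+1)); last by rewrite leq_mul2l ltn_ord orbT.
by rewrite mulnSr ltn_add2l.
Qed.

Lemma quot_lt Q b (x : 'I_(Q * b)) : (x %/ Q < b)%N.
Proof.
have Q0 : (0 < Q)%N by case: Q x => // -[m]; rewrite mul0n.
by rewrite ltn_divLR // (leq_trans (ltn_ord x)) // mulnC.
Qed.

Lemma rem_lt Q b (x : 'I_(Q * b)) : (x %% Q < Q)%N.
Proof. by apply: ltn_pmod; case: Q x => // -[m]; rewrite mul0n. Qed.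

Section BoxSums.
Variables (R : realType) (s : nat).
Implicit Types (G : nat -> ('I_s -> nat) -> R[i]).

(** The summand receives [h] as a function into [nat], so that it makes sense for every range [b]
    and digits can be recombined. *)
Definition bsum (n b : nat) G : R[i] :=
  \sum_(x < n) \sum_(h : {ffun 'I_s -> 'I_b}) G x (fun i => h i : nat).

Lemma eq_bsum n b G1 G2 :
  (forall x h, (x < n)%N -> (forall i, (h i < b)%N) -> G1 x h = G2 x h) ->
  bsum n b G1 = bsum n b G2.
Proof.
move=> eqG; apply: eq_bigr => x _; apply: eq_bigr => h _.
by apply: eqG => // i.
Qed.

Lemma bsumZ n b c G : bsum n b (fun x h => c * G x h) = c * bsum n b G.
Proof.
by rewrite /bsum big_distrr; apply: eq_bigr => x _; rewrite big_distrr.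
Qed.

Lemma exchange_bsum n b n' b' (G : nat -> ('I_s -> nat) -> nat -> ('I_s -> nat) -> R[i]) :
  bsum n b (fun x h => bsum n' b' (G x h)) =
  bsum n' b' (fun y k => bsum n b (fun x h => G x h y k)).
Proof.
rewrite /bsum; under eq_bigr => x _.
  rewrite exchange_big; under eq_bigr => y _ do rewrite exchange_big.
  over.
rewrite exchange_big; apply: eq_bigr => y _; rewrite exchange_big.
by [].
Qed.

Lemma bsum_digit Q a b G :
  bsum (Q * a) (Q * b) G =
  bsum a b (fun x h => bsum Q Q (fun y k =>
    G (Q * x + y)%N (fun i => Q * h i + k i)%N)).
Proof.
rewrite /bsum (big_digit _ _ (fun x => \sum_(h : {ffun 'I_s -> 'I_(Q * b)}) G x (fun i => h i : nat))).
apply: eq_bigr => x _; rewrite [RHS]exchange_big; apply: eq_bigr => y _.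
rewrite pair_big /=.
rewrite (reindex (fun p : {ffun 'I_s -> 'I_b} * {ffun 'I_s -> 'I_Q} =>
   [ffun i => Ordinal (digit_lt (p.1 i) (p.2 i))])) /=; last first.
  exists (fun h : {ffun 'I_s -> 'I_(Q * b)} =>
    ([ffun i => Ordinal (quot_lt (h i))], [ffun i => Ordinal (rem_lt (h i))])).
    move=> [k m] _; congr (_, _); apply/ffunP => i; apply/val_inj;
      rewrite !ffunE /=.
      have Q0 : (0 < Q)%N by case: Q m {G y} => [m|//]; case: (m i).
      by rewrite mulnC divnMDl // divn_small ?addn0.
    by rewrite mulnC modnMDl modn_small.
  move=> h _; apply/ffunP => i; apply/val_inj; rewrite !ffunE /=.
  by rewrite mulnC -divn_eq.
apply: eq_bigr => -[k m] _ /=; congr G; apply/funext => i.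
by rewrite ffunE.
Qed.

Lemma cabs_bsum_le n b G (M : R) :
  (forall x h, (x < n)%N -> (forall i, (h i < b)%N) -> cabs (G x h) <= M) ->
  cabs (bsum n b G) <= (n * b ^ s)%:R * M.
Proof.
move=> leGM; apply: le_trans (cabs_sum_le _ _ _) _.
apply: (@le_trans _ _ (\sum_(x < n) \sum_(h : {ffun 'I_s -> 'I_b}) M)).
  apply: ler_sum => x _; apply: le_trans (cabs_sum_le _ _ _) _.
  by apply: ler_sum => h _; apply: leGM => // i.
by rewrite !sumr_const card_ffun !card_ord -mulrnA mulnC mulr_natl.
Qed.

(** Two distinguished terms are kept together to exploit their cancellation; every other term is
    bounded by [M]. *)
Lemma cabs_bsum_le2 n b G (M D : R) (x1 x2 : 'I_n) (h1 h2 : {ffun 'I_s -> 'I_b}) :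
  (x1, h1) != (x2, h2) ->
  (forall x h, (x < n)%N -> (forall i, (h i < b)%N) -> cabs (G x h) <= M) ->
  cabs (G x1 (fun i => h1 i : nat) + G x2 (fun i => h2 i : nat)) <= D ->
  cabs (bsum n b G) <= (n * b ^ s)%:R * M - 2 * M + D.
Proof.
move=> neq12 leGM leD.
rewrite /bsum pair_big /= (bigD1 (x1, h1)) //= (bigD1 (x2, h2)) /=; last by rewrite eq_sym.
rewrite addrA; apply: le_trans (cabs_le_add _ _) _.
rewrite [leRHS]addrC; apply: lerD => //.
apply: le_trans (cabs_sum_le _ _ _) _.
apply: (@le_trans _ _ (\sum_(i | (i != (x1, h1)) && (i != (x2, h2))) M)).
  by apply: ler_sum => -[x h] _; apply: leGM => // i.
(* The remaining terms are counted by removing the same two indices from a constant sum. *)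
have := erefl (\sum_(i : 'I_n * {ffun 'I_s -> 'I_b}) M).
rewrite [in X in _ = X -> _]sumr_const card_prod card_ffun !card_ord.
rewrite (bigD1 (x1, h1)) //= (bigD1 (x2, h2)) /=; last by rewrite eq_sym.
rewrite -[_ *+ _]mulr_natl; lra.
Qed.

End BoxSums.

Definition wsum (s : nat) (w : {ffun 'I_s -> bool}) (x : nat) (h : 'I_s -> nat) : nat :=
  (x + \sum_(i | w i) h i)%N.

(* [r w] is the carry entering a block of digits at the vertex [w] of the cube,
   and [Psi] is evaluated at the carries leaving the block; the sum over the
   block is not normalised. *)
Definition transfer (R : realType) (s Q : nat) (g : nat -> R[i])
    (Psi : ({ffun 'I_s -> bool} -> nat) -> R[i]) (r : {ffun 'I_s -> bool} -> nat) : R[i] :=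
  bsum Q Q (fun x h =>
    (\prod_(w : {ffun 'I_s -> bool}) conj_pow (weight w) (g ((wsum w x h + r w) %% Q)%N)) *
    Psi (fun w => (wsum w x h + r w) %/ Q)%N).

(* Carries in a sum of [s + 1] numbers never exceed [s]. *)
Definition carry_bounded (R : realType) (s : nat) (M : R)
    (Psi : ({ffun 'I_s -> bool} -> nat) -> R[i]) : Prop :=
  forall r, (forall w, (r w <= s)%N) -> cabs (Psi r) <= M.

Lemma wsum_digit s (w : {ffun 'I_s -> bool}) Q x y (h k : 'I_s -> nat) :
  wsum w (Q * x + y)%N (fun i => Q * h i + k i)%N =
  (Q * wsum w x h + wsum w y k)%N.
Proof.
by rewrite /wsum big_split /= mulnDr big_distrr /= !addnA (addnAC (Q * x)%N).
Qed.

Lemma wsum_const s (w : {ffun 'I_s -> bool}) x c :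
  wsum w x (fun=> c) = (x + c * weight w)%N.
Proof. by rewrite /wsum weightE big_distrr /=; under [in RHS]eq_bigr do rewrite muln1. Qed.

Lemma wsum_le s (w : {ffun 'I_s -> bool}) Q x (h : 'I_s -> nat) : (x < Q)%N ->
  (forall i, (h i < Q)%N) -> (wsum w x h <= s.+1 * Q.-1)%N.
Proof.
move=> ltx lth; rewrite /wsum mulSn leq_add //; first by lia.
apply: (@leq_trans (\sum_(i | w i) Q.-1)%N).
  by apply: leq_sum => i _; have := lth i; lia.
rewrite sum_nat_const leq_mul2r; apply/orP; right; exact: weight_le.
Qed.

(** The point is that [(s + 1) * (Q - 1) + s] is smaller than [(s + 1) * Q]. *)
Lemma carry_le s (w : {ffun 'I_s -> bool}) Q x (h : 'I_s -> nat) r : (x < Q)%N ->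
  (forall i, (h i < Q)%N) -> (r <= s)%N -> ((wsum w x h + r) %/ Q <= s)%N.
Proof.
move=> ltx lth les; rewrite -ltnS ltn_divLR; last by lia.
have := wsum_le w ltx lth; have : (0 < Q)%N by lia.
case: Q {ltx lth} => // Q _; rewrite mulnS /=; lia.
Qed.

Lemma modn_digit Q1 Q2 z c : (c < Q1)%N ->
  ((Q1 * z + c) %% (Q1 * Q2) = c + Q1 * (z %% Q2))%N.
Proof.
move=> ltc; case: (posnP Q2) => [->|Q20]; first by rewrite muln0 !modn0 addnC.
rewrite {1}(divn_eq z Q2) mulnDr mulnCA -addnA modnMDl modn_small ?(addnC c) //.
apply: (@leq_trans (Q1 * (z %% Q2).+1)); first by rewrite mulnSr ltn_add2l.
by rewrite leq_mul2l ltn_pmod // orbT.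
Qed.

Lemma divn_digit Q1 Q2 z c : (c < Q1)%N ->
  ((Q1 * z + c) %/ (Q1 * Q2) = z %/ Q2)%N.
Proof.
move=> ltc; have Q10 : (0 < Q1)%N by lia.
by rewrite divnMA (mulnC Q1) divnMDl // (divn_small ltc) addn0.
Qed.

Section Transfer.
Variables (R : realType) (s : nat).
Implicit Types (g f : nat -> R[i]).
Local Notation cube := {ffun 'I_s -> bool}.
Implicit Types (Psi : (cube -> nat) -> R[i]) (r : cube -> nat).

Local Notation unim u := (forall n : nat, cabs (u n) = 1).

Lemma conj_powM k (z w : R[i]) : conj_pow k (z * w) = conj_pow k z * conj_pow k w.
Proof. by rewrite /conj_pow; case: odd => //; rewrite rmorphM. Qed.

(** Every summation variable splits into a low digit in base [Q1] and a high part. The low digits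
    turn [r] into the carry entering the high block, and multiplicativity of [g] separates the
    phases. *)
Lemma transfer_comp Q1 Q2 g Psi r : (0 < Q1)%N ->
  (forall a b, (a < Q1)%N -> g (a + Q1 * b)%N = g a * g (Q1 * b)%N) ->
  transfer (Q1 * Q2) g Psi r =
  transfer Q1 g (transfer Q2 (dilate Q1 g) Psi) r.
Proof.
move=> Q10 gM; rewrite /transfer bsum_digit exchange_bsum.
apply: eq_bsum => y k lty ltk; rewrite -bsumZ; apply: eq_bsum => x h _ _.
set c := fun w : cube => (wsum w y k + r w)%N.
have E w : (wsum w (Q1 * x + y) (fun i => Q1 * h i + k i) + r w =
   Q1 * (wsum w x h + c w %/ Q1) + c w %% Q1)%N.
  by rewrite wsum_digit -addnA -/(c w) {1}(divn_eq (c w) Q1) (mulnC (c w %/ Q1)%N) mulnDr addnA.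
rewrite mulrA; congr (_ * _).
  rewrite -big_split /=; apply: eq_bigr => w _; rewrite -conj_powM.
  by rewrite E modn_digit ?ltn_pmod // gM ?ltn_pmod.
by congr Psi; apply/funext => w; rewrite E divn_digit ?ltn_pmod.
Qed.

Lemma cabs_phase g (e : cube -> nat) : unim g ->
  cabs (\prod_w conj_pow (weight w) (g (e w))) = 1.
Proof.
by move=> g1; rewrite cabs_prod big1 // => w _; rewrite cabs_conj_pow g1.
Qed.

Lemma transfer_bound Q g Psi M : unim g -> carry_bounded M Psi ->
  carry_bounded ((Q ^ s.+1)%:R * M) (transfer Q g Psi).
Proof.
move=> g1 PsiM r les; rewrite /transfer expnS; apply: cabs_bsum_le => x h ltx lth.
rewrite cabsM cabs_phase // mul1r; apply: PsiM => w; exact: carry_le.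
Qed.

(** The first cube coordinate selects one of the two factors of the outermost [mdiff]. *)
Lemma cube_diff g n : iter s (mdiff 1) g n =
  \prod_(w : cube) conj_pow (weight w) (g (n + weight w)%N).
Proof.
elim: s n => [|d IHd] n.
  rewrite (big_pred1 [ffun=> false]) => [|w]; last first.
    by apply/esym/eqP/ffunP => -[].
  by rewrite /weight eq_card0 ?addn0 // => -[].
rewrite iterS /mdiff !IHd big_fcons /= big_bool /= mulrC rmorph_prod /=.
congr (_ * _); apply: eq_bigr => w _; rewrite weight_fcons ?add0n //.
by rewrite add1n addn1 addSnnS /conj_pow /=; case: odd; rewrite ?conjcK.
Qed.

(* Both [0] and [(Q1 x, Q1, ..., Q1)] send any admissible carry to [0], and
   their phases differ by the factor [iter s (mdiff 1) (dilate Q1 g) x]; the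
   triangle inequality loses accordingly. *)
Lemma transfer_block Q1 Q2 g Psi M x : (0 < s)%N -> (s < Q1)%N -> (x + s < Q2)%N ->
  unim g ->
  (forall a b, (a < Q1)%N -> g (a + Q1 * b)%N = g a * g (Q1 * b)%N) ->
  carry_bounded M Psi ->
  carry_bounded ((((Q1 * Q2) ^ s.+1)%:R -
     cabs (1 - iter s (mdiff 1) (dilate Q1 g) x) ^+ 2 / 4) * M) (transfer (Q1 * Q2) g Psi).
Proof.
move=> s0 ltsQ ltxQ g1 gM PsiM r les; rewrite /transfer.
set Q := (Q1 * Q2)%N; set D := iter s _ _ _.
have M0 : 0 <= M by apply: le_trans (PsiM (fun=> 0%N) _); rewrite ?cabs_ge0.
have Q10 : (0 < Q1)%N by lia.
have xQ : (Q1 * x < Q)%N by rewrite ltn_pmul2l //; lia.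
have oneQ : (Q1 < Q)%N by rewrite -[X in (X < _)%N]muln1 ltn_pmul2l //; lia.
have Q0 : (0 < Q)%N by lia.
pose x1 := Ordinal Q0; pose h1 : {ffun 'I_s -> 'I_Q} := [ffun=> Ordinal Q0].
pose x2 := Ordinal xQ; pose h2 : {ffun 'I_s -> 'I_Q} := [ffun=> Ordinal oneQ].
have D1 : cabs D = 1.
  by apply: iter_mdiff_unim => n; rewrite /dilate.
pose p := \prod_(w : cube) conj_pow (weight w) (g (r w)).
have p1 : cabs p = 1 by exact: cabs_phase.
have neq12 : (x1, h1) != (x2, h2).
  apply/eqP => /(congr1 snd) /= /ffunP /(_ (Ordinal s0)) /(congr1 val).
  by rewrite !ffunE /= => Q1E; move: Q10; rewrite -Q1E.
have -> : ((Q ^ s.+1)%:R - cabs (1 - D) ^+ 2 / 4) * M =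
  (Q * Q ^ s)%:R * M - 2 * M + (2 - cabs (1 - D) ^+ 2 / 4) * M by rewrite -expnS; ring.
apply: (cabs_bsum_le2 neq12) => [y k lty ltk|].
  rewrite cabsM cabs_phase // mul1r; apply: PsiM => w; exact: carry_le.
have ltrQ w : (r w < Q1)%N by apply: leq_ltn_trans (les w) ltsQ.
have -> : (fun i => h1 i : nat) = (fun=> 0%N) by apply/funext => i; rewrite ffunE.
have -> : (fun i => h2 i : nat) = (fun=> Q1) by apply/funext => i; rewrite ffunE.
have E1 w : (wsum w x1 (fun=> 0%N) + r w = r w)%N by rewrite wsum_const.
have E2 w : (wsum w x2 (fun=> Q1) + r w = Q1 * (x + weight w) + r w)%N.
  by rewrite wsum_const /= mulnDr.
have rQ w : (r w < Q)%N by apply: ltn_trans (ltrQ w) oneQ.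
(* Since [x + s < Q2], no vertex of the second cube overflows the block, so its outgoing carry is
   [0] as well. *)
have tQ w : (Q1 * (x + weight w) + r w < Q)%N.
  apply: (@leq_trans (Q1 * (x + weight w).+1)); first by rewrite mulnSr ltn_add2l.
  by rewrite leq_mul2l; have := weight_le w; lia.
have -> : (fun w : cube => (wsum w x1 (fun=> 0%N) + r w) %/ Q)%N = (fun=> 0%N).
  by apply/funext => w; rewrite E1 divn_small.
have -> : (fun w : cube => (wsum w x2 (fun=> Q1) + r w) %/ Q)%N = (fun=> 0%N).
  by apply/funext => w; rewrite E2 divn_small.
have -> : \prod_(w : cube) conj_pow (weight w) (g ((wsum w x1 (fun=> 0) + r w) %% Q)%N) = p.
  by apply: eq_bigr => w _; rewrite E1 modn_small.
have -> : \prod_(w : cube) conj_pow (weight w) (g ((wsum w x2 (fun=> Q1) + r w) %% Q)%N) = p * D.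
  rewrite /D cube_diff -big_split; apply: eq_bigr => w _ /=.
  by rewrite E2 modn_small // addnC gM // conj_powM.
rewrite -mulrDl -{1}[p]mulr1 -mulrDr !cabsM p1 mul1r.
apply: ler_pM; rewrite ?cabs_ge0 //; last by apply: PsiM.
(* From [a ^+ 2 + b ^+ 2 = 4] and [(a - 2) ^+ 2 >= 0] follows [a <= 2 - b ^+ 2 / 4]. *)
have := parallelogram1 D1; have := sqr_ge0 (cabs (1 + D) - 2).
set a := cabs (1 + D); set b := cabs (1 - D); rewrite sqrrB => h1' h2'; lra.
Qed.

End Transfer.

(** * Exponential decay of transfer operators *)

Lemma eq_ler (R : realType) (x y : R) : x = y -> x <= y.
Proof. by move=> ->. Qed.

Lemma exists_ge_avg (R : realType) n (F : 'I_n -> R) : (0 < n)%N ->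
  exists i, \sum_j F j <= n%:R * F i.
Proof.
move=> n0; case: (@arg_maxP _ _ _ (Ordinal n0) xpredT F isT) => i _ maxi.
exists i; rewrite -[n in n%:R]card_ord mulr_natl -sumr_const.
by apply: ler_sum => j _; exact: maxi.
Qed.

(** This is [sigma_t] of the overview. A sum dominates each single difference, and averaging
    recovers a large one from it. *)
Definition defect (R : realType) (q s Ms : nat) (f : nat -> R[i]) (t : nat) : R :=
  \sum_(n < Ms) cabs (1 - iter s (mdiff 1) (dilate (q ^ t) f) n).

Section BlockDecay.
Variables (R : realType) (q s Ms K J : nat).
Hypotheses (q1 : (1 < q)%N) (s0 : (0 < s)%N) (Ms0 : (0 < Ms)%N).
Hypotheses (sK : (s < q ^ K)%N) (MsJ : (Ms + s <= q ^ J)%N).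
Variable f : nat -> R[i].
Hypotheses (f1 : unimodular f) (fM : q_multiplicative q f).
Implicit Types (Psi : ({ffun 'I_s -> bool} -> nat) -> R[i]).

(** The [K] low digits of a block absorb the incoming carries; the [J] others leave room for the
    vertices [x + weight w] with [x < Ms]. Hence a block starting at [t] sees the defect at
    [t + K]. *)
Let B := (K + J)%N.
(** The [4] is the loss in [transfer_block], the power of [q ^ B] is the number of terms in a block,
    and [Ms ^ 2] comes from passing from the sum [sigma] to a single difference. *)
Let c0 : R := (4 * (q ^ B)%:R ^+ s.+1 * Ms%:R ^+ 2)^-1.
Local Notation sigma := (defect q s Ms f).

Let qpos k : (0 < q ^ k)%N.
Proof. by rewrite expn_gt0 ltnW. Qed.

Let qposR k : 0 < (q ^ k)%:R :> R.
Proof. by rewrite ltr0n. Qed.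

Let dil_unim k n : cabs (dilate k f n) = 1.
Proof. by rewrite /dilate; exact: unimodularP. Qed.

(** Some difference is at least the average [sigma / Ms]; [transfer_block] is applied there, and
    [1 - y <= expR (- y)] makes the gain exponential. *)
Lemma transfer_block_decay t M Psi : carry_bounded M Psi ->
  carry_bounded ((q ^ B)%:R ^+ s.+1 * M * expR (- (c0 * sigma (t + K)%N ^+ 2)))
    (transfer (q ^ B) (dilate (q ^ t) f) Psi).
Proof.
move=> PsiM r les.
have M0 : 0 <= M by apply: le_trans (PsiM (fun=> 0%N) _); rewrite ?cabs_ge0.
have [x hx] := exists_ge_avg (fun n : 'I_Ms =>
  cabs (1 - iter s (mdiff 1) (dilate (q ^ (t + K)) f) n)) Ms0.
have gM a b : (a < q ^ K)%N -> dilate (q ^ t) f (a + q ^ K * b)%N =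
    dilate (q ^ t) f a * dilate (q ^ t) f (q ^ K * b)%N.
  exact: (q_mult_dilate _ _ (ltnW q1)).
have xJ : (x + s < q ^ J)%N by apply: leq_trans MsJ; rewrite ltn_add2r.
have := @transfer_block R s (q ^ K) (q ^ J) (dilate (q ^ t) f) Psi M x s0 sK xJ
  (dil_unim _) gM PsiM r les.
rewrite -expnD -/B dilateM -expnD => /le_trans; apply.
rewrite [leRHS]mulrAC ler_wpM2r // natrX.
set A := (q ^ B)%:R ^+ s.+1; have A0 : 0 < A by rewrite exprn_gt0.
set b := cabs _ in hx *; rewrite -/(sigma (t + K)%N) in hx.
have s_ge0 : 0 <= sigma (t + K)%N by apply: sumr_ge0 => i _; exact: cabs_ge0.
have MsR : 0 < Ms%:R :> R by rewrite ltr0n.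
have sb : sigma (t + K)%N ^+ 2 <= Ms%:R ^+ 2 * b ^+ 2.
  by rewrite -exprMn ler_sqr ?nnegrE // (le_trans s_ge0).
have h1 : c0 * sigma (t + K)%N ^+ 2 <= b ^+ 2 / (4 * A).
  rewrite /c0 -/A mulrC ler_pdivrMr; last by rewrite !mulr_gt0 // exprn_gt0.
  apply: le_trans sb _; apply: eq_ler; field; exact: lt0r_neq0.
apply: (@le_trans _ _ (A * (1 - b ^+ 2 / (4 * A)))).
  apply: eq_ler; field; exact: lt0r_neq0.
apply: (ler_wpM2l (ltW A0)); apply: le_trans _ (expR_ge1Dx _).
by rewrite lerD2l lerN2.
Qed.

Lemma transfer_chain_decay j t M Psi : carry_bounded M Psi ->
  carry_bounded ((q ^ (B * j))%:R ^+ s.+1 * M *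
      expR (- (c0 * \sum_(k < j) sigma (t + K + B * k)%N ^+ 2)))
    (transfer (q ^ (B * j)) (dilate (q ^ t) f) Psi).
Proof.
elim: j t Psi M => [|j IHj] t Psi M PsiM r les.
  rewrite muln0 expn0 big_ord0 mulr0 oppr0 expR0 mulr1 -natrX.
  have := transfer_bound 1 (dil_unim (q ^ t)) PsiM les; exact.
rewrite mulnS expnD transfer_comp //; last first.
  by move=> a b; exact: (q_mult_dilate _ _ (ltnW q1)).
rewrite dilateM -expnD.
have := transfer_block_decay t (IHj (t + B)%N _ _ PsiM) les.
move=> /le_trans; apply; rewrite natrM exprMn big_ord_recl muln0 addn0.
under [in leRHS]eq_bigr => k _ do rewrite /= /bump add1n mulnS addnA.
rewrite mulrDr opprD expRD; apply: eq_ler.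
rewrite (_ : (t + B + K = t + K + B)%N); last by rewrite addnAC.
ring.
Qed.

(* Blocks of length [B] can start at any residue modulo [B]; the best residue
   captures a proportion [1 / B] of all defects. *)
Lemma transfer_decay j M Psi : carry_bounded M Psi ->
  carry_bounded ((q ^ (B * j))%:R ^+ s.+1 * M *
      expR (- (c0 / B%:R * \sum_(t < B * j.-1) sigma (t + K)%N ^+ 2)))
    (transfer (q ^ (B * j)) f Psi).
Proof.
move=> PsiM r les.
have M0 : 0 <= M by apply: le_trans (PsiM (fun=> 0%N) _); rewrite ?cabs_ge0.
have f_dil : f = dilate (q ^ 0) f by apply/funext => n; rewrite /dilate mul1n.
case: j => [|j] /=.
  rewrite muln0 expn0 big_ord0 mulr0 oppr0 expR0 mulr1 -natrX.
  have := transfer_bound 1 (dil_unim (q ^ 0)) PsiM les; rewrite -f_dil; exact.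
have B0 : (0 < B)%N by rewrite /B; case: K sK => // ; rewrite ltnNge s0.
have [i hi] := exists_ge_avg (fun i : 'I_B =>
  \sum_(k < j) sigma (i + K + B * k)%N ^+ 2) B0.
(* The digits are cut into [i] low ones, [j] full blocks and [B - i] high ones; both ends are
   bounded trivially. *)
have BE : (B * j.+1 = i + (B * j + (B - i)))%N by have := ltn_ord i; rewrite mulnS; lia.
rewrite BE expnD [X in transfer _ X _]f_dil transfer_comp //; last first.
  by move=> a b; exact: (q_mult_dilate _ _ (ltnW q1)).
rewrite dilateM -(expnD q 0 i) add0n (expnD q (B * j) (B - i)).
set T := transfer (q ^ (B * j) * q ^ (B - i)) _ _.
have {}hT : carry_bounded ((q ^ (B * j) * q ^ (B - i))%:R ^+ s.+1 * M *
    expR (- (c0 * \sum_(k < j) sigma (i + K + B * k)%N ^+ 2))) T.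
  move=> r' les'; rewrite /T transfer_comp //; last first.
    by move=> a b; exact: (q_mult_dilate _ _ (ltnW q1)).
  rewrite dilateM -expnD.
  have := transfer_chain_decay j i
    (transfer_bound (q ^ (B - i)) (dil_unim (q ^ (i + B * j))) PsiM) les'.
  by rewrite (natrX _ (q ^ (B - i))) natrM exprMn !mulrA.
have := transfer_bound (q ^ i) (dil_unim (q ^ 0)) hT les.
move=> /le_trans; apply; rewrite (natrX _ (q ^ i)) !mulrA -exprMn -natrM.
apply: ler_wpM2l; first by rewrite mulr_ge0 // exprn_ge0 // !mulr_ge0 // ?ltW.
rewrite ler_expR lerN2 -mulrA ler_wpM2l //.
  by rewrite /c0 invr_ge0 !mulr_ge0 // exprn_ge0 // ltW.
rewrite mulrC ler_pdivrMr ?ltr0n //; apply: le_trans (_ : _ <= _ ) _; last first.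
  by rewrite mulrC; exact: hi.
rewrite exchange_big (big_digit _ _ (fun t => sigma (t + K)%N ^+ 2)).
apply: eq_ler; apply: eq_bigr => k _; apply: eq_bigr => m _.
by rewrite -addnA addnC.
Qed.

End BlockDecay.

(** * Gowers sums *)

(** For zero-extended summands this allows any range of summation that covers the support. *)
Lemma sum_supported (V : nmodType) (G : int -> V) (n m : nat) (u v : int) :
  (forall y, ~~ ((u <= y) && (y < u + m%:Z)) -> G y = 0) ->
  v <= u -> u + m%:Z <= v + n%:Z ->
  \sum_(a < n) G (a%:Z + v) = \sum_(b < m) G (b%:Z + u).
Proof.
move=> G0 levu leuv.
have [k uE] : exists k : nat, u = v + k%:Z by exists (absz (u - v)); lia.
have [k' nE] : exists k', n = (k + (m + k'))%N by exists (n - k - m)%N; lia.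
rewrite nE !big_split_ord /= big1 ?add0r => [|i _]; last first.
  by apply: G0; have := ltn_ord i; lia.
rewrite [X in _ + X]big1 ?addr0 => [|i _]; last first.
  by apply: G0; lia.
by apply: eq_bigr => i _; congr G; rewrite uE; lia.
Qed.

Section GowersSums.
Variable R : realType.
Implicit Types (F G : int -> R[i]) (f : nat -> R[i]).

(** Extension by zero replaces the constraint [in_Pi]: a product over a cube with a vertex outside
    [[0, N)] vanishes. *)
Definition cutoff (N : nat) (f : nat -> R[i]) (y : int) : R[i] :=
  if (0 <= y) && (y < N%:Z) then f (absz y) else 0.

Definition dprod (s : nat) F (x : int) (h : 'I_s -> int) : R[i] :=
  \prod_(w : {ffun 'I_s -> bool}) conj_pow (weight w) (F (x + \sum_(i | w i) h i)).

Definition gsum (s N : nat) F : R[i] :=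
  \sum_(x < N) \sum_(h : {ffun 'I_s -> 'I_(2 * N)})
    dprod F x%:Z (fun i => (h i)%:Z - N%:Z).

Definition supported (N : nat) F :=
  forall y, ~~ ((0 <= y) && (y < N%:Z)) -> F y = 0.

Lemma cutoff_supported N f : supported N (cutoff N f).
Proof. by move=> y /negbTE h; rewrite /cutoff h. Qed.

Lemma conj_pow0 k : conj_pow k (0 : R[i]) = 0.
Proof. by rewrite /conj_pow; case: odd; rewrite ?rmorph0. Qed.

Lemma conj_powS k (z : R[i]) : conj_pow k.+1 z = conjc (conj_pow k z).
Proof. by rewrite /conj_pow /=; case: odd; rewrite ?conjcK. Qed.

Lemma conj_powB k (z w : R[i]) : conj_pow k (z - w) = conj_pow k z - conj_pow k w.
Proof. by rewrite /conj_pow; case: odd => //; rewrite rmorphB. Qed.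

Lemma dprod_supported s N F (h : 'I_s -> int) : supported N F ->
  supported N (fun x => dprod F x h).
Proof.
move=> F0 y ny; rewrite /dprod (bigD1 [ffun=> false]) //= big1 => [|i]; last first.
  by rewrite ffunE.
by rewrite addr0 F0 // conj_pow0 mul0r.
Qed.

Lemma dprodS s F x (h : 'I_s.+1 -> int) :
  dprod F x h = dprod F x (fun i => h (lift ord0 i)) *
    conjc (dprod F (x + h ord0) (fun i => h (lift ord0 i))).
Proof.
rewrite /dprod big_fcons /= big_bool /= mulrC rmorph_prod /=.
congr (_ * _); apply: eq_bigr => w _; rewrite weight_fcons ?add0n sum_fcons.
  by rewrite mulr0n add0r.
by rewrite add1n conj_powS mulr1n addrA.
Qed.

Lemma dprodM s F G x (h : 'I_s -> int) :
  dprod (fun y => F y * G y) x h = dprod F x h * dprod G x h.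
Proof. by rewrite /dprod -big_split; apply: eq_bigr => w _; rewrite conj_powM. Qed.

Lemma dprod_conj_shift s F x (c : int) (h : 'I_s -> int) :
  dprod (fun y => conjc (F (y + c))) x h = conjc (dprod F (x + c) h).
Proof.
rewrite /dprod rmorph_prod; apply: eq_bigr => w _ /=.
by rewrite (addrAC x) /conj_pow; case: odd.
Qed.

Lemma gsum_fcons s N F : gsum s.+1 N F = \sum_(x < N) \sum_(a < 2 * N)
  \sum_(h : {ffun 'I_s -> 'I_(2 * N)})
    dprod F x%:Z (fun i => (h i)%:Z - N%:Z) *
    conjc (dprod F (x%:Z + (a%:Z - N%:Z)) (fun i => (h i)%:Z - N%:Z)).
Proof.
rewrite /gsum; apply: eq_bigr => x _; rewrite big_fcons /=.
apply: eq_bigr => a _; apply: eq_bigr => h _.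
rewrite dprodS fcons0.
have E : (fun i : 'I_s => (fcons a h (lift ord0 i))%:Z - N%:Z) =
    (fun i => (h i)%:Z - N%:Z) by apply/funext => i; rewrite fconsS.
by rewrite E.
Qed.

Lemma gsum_diff s N F : gsum s.+1 N F =
  \sum_(a < 2 * N) gsum s N (fun y => F y * conjc (F (y + (a%:Z - N%:Z)))).
Proof.
rewrite gsum_fcons exchange_big; apply: eq_bigr => a _.
apply: eq_bigr => x _; apply: eq_bigr => h _.
by rewrite dprodM dprod_conj_shift.
Qed.

(** For [x] in [[0, N)] the shifts by [[-N, N)] reach the whole support of [F], so the sum over the
    first step does not depend on [x] and the double sum is a square. This yields positivity. *)
Lemma gsum_square s N F : supported N F -> gsum s.+1 N F =
  (\sum_(h : {ffun 'I_s -> 'I_(2 * N)})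
    cabs (\sum_(x < N) dprod F x%:Z (fun i => (h i)%:Z - N%:Z)) ^+ 2)%:C%C.
Proof.
move=> F0; rewrite gsum_fcons.
under eq_bigr => x _ do rewrite exchange_big.
rewrite exchange_big rmorph_sum /=; apply: eq_bigr => h _.
rewrite -mul_conjc big_distrl; apply: eq_bigr => x _ /=.
rewrite -big_distrr /= rmorph_sum; congr (_ * _).
pose P y := conjc (dprod F y (fun i => (h i)%:Z - N%:Z)).
have P0 y : ~~ ((0 <= y) && (y < 0 + N%:Z)) -> P y = 0.
  by rewrite add0r /P => ny; rewrite (dprod_supported _ F0) ?rmorph0.
transitivity (\sum_(a < 2 * N) P (a%:Z + (x%:Z - N%:Z))).
  by apply: eq_bigr => a _; congr P; rewrite addrCA.
rewrite (sum_supported P0); first by under eq_bigr do rewrite addr0.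
- by have := ltn_ord x; lia.
- by have := ltn_ord x; lia.
Qed.

(** Here [N] also sets the range of the steps. Induction through [gsum_diff] shows that steps beyond
    [N'] contribute nothing. *)
Lemma gsum_shrink s N' N F : (N' <= N)%N -> supported N' F ->
  gsum s N F = gsum s N' F.
Proof.
move=> leN; elim: s F => [|s IHs] F F0.
  rewrite /gsum.
  have E M : \sum_(x < M) \sum_(h : {ffun 'I_0 -> 'I_(2 * M)})
      dprod F x%:Z (fun i => (h i)%:Z - M%:Z) = \sum_(x < M) F (x%:Z + 0).
    apply: eq_bigr => x _.
    rewrite (big_pred1 [ffun i : 'I_0 => match i with Ordinal _ i0 => False_rect _ (notF i0) end]); last first.
      by move=> w; apply/esym/eqP/ffunP => -[].
    rewrite /dprod (big_pred1 [ffun=> false]); last first.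
      by move=> w; apply/esym/eqP/ffunP => -[].
    by rewrite big1 => [|[]] //; rewrite /weight eq_card0 // => -[].
  rewrite !E; apply: sum_supported => [y||]; rewrite ?add0r ?lez_nat //; exact: F0.
rewrite !gsum_diff.
pose D (d : int) := gsum s N' (fun y => F y * conjc (F (y + d))).
(* A step outside [[-N', N')] moves every point of the support out of it. *)
have D0 d : ~~ ((- N'%:Z <= d) && (d < - N'%:Z + (2 * N')%:Z)) -> D d = 0.
  move=> nd; rewrite /D /gsum big1 // => x _; rewrite big1 // => h _.
  rewrite dprodM dprod_conj_shift.
  have := @dprod_supported _ _ _ (fun i => (h i)%:Z - N'%:Z) F0 (x%:Z + d).
  by move=> ->; rewrite ?rmorph0 ?mulr0 //; have := ltn_ord x; lia.
transitivity (\sum_(a < 2 * N) D (a%:Z + - N%:Z)); last first.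
  by rewrite (sum_supported D0) //; lia.
apply: eq_bigr => a _; apply: IHs => y ny.
by rewrite F0 ?mul0r.
Qed.

End GowersSums.

(** * Upper bound for the Gowers averages *)

Lemma cabs_prodB (R : realType) (I : Type) (r : seq I) (F G : I -> R[i]) :
  (forall i, cabs (F i) <= 1) -> (forall i, cabs (G i) <= 1) ->
  cabs (\prod_(i <- r) F i - \prod_(i <- r) G i) <=
  \sum_(i <- r) cabs (F i - G i).
Proof.
move=> F1 G1; elim: r => [|i r IHr]; first by rewrite !big_nil subrr cabs0.
rewrite !big_cons; set a := \prod_(j <- r) F j; set b := \prod_(j <- r) G j.
have b1 : cabs b <= 1.
  by rewrite /b cabs_prod prodr_ile1 // => j _; rewrite cabs_ge0 G1.
have -> : F i * a - G i * b = F i * (a - b) + (F i - G i) * b by ring.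
apply: le_trans (cabs_le_add _ _) _; rewrite addrC !cabsM.
apply: lerD; first by rewrite ler_piMr ?cabs_ge0.
by apply: le_trans IHr; rewrite ler_piMl ?cabs_ge0.
Qed.

Lemma card_Pi_le s N : (card_Pi s N <= N * (2 * N) ^ s)%N.
Proof.
apply: (@leq_trans (\sum_(x < N) \sum_(h : {ffun 'I_s -> 'I_(2 * N)}) 1)%N).
  by apply: leq_sum => x _; rewrite [leqRHS](bigID (in_Pi x)) /= leq_addr.
by rewrite !sum_nat_const card_ffun !card_ord muln1.
Qed.

(** All cubes with base point and steps in [[0, p)] are admissible as soon as
    [(s + 1) * (p - 1) < N], and [p] can be taken at least [N / (s + 1)]. *)
Lemma card_Pi_ge s N : (0 < N)%N -> (N ^ s.+1 <= card_Pi s N * s.+1 ^ s.+1)%N.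
Proof.
move=> N0; pose p := (N.-1 %/ s.+1).+1.
have pN : (s.+1 * p.-1 < N)%N by rewrite mulnC; have := leq_trunc_div N.-1 s.+1; rewrite /p /=; lia.
have Np : (N <= p * s.+1)%N by have := ltn_ceil N.-1 (ltn0Sn s); rewrite -/p; lia.
apply: (@leq_trans ((p * s.+1) ^ s.+1)); first by rewrite leq_exp2r.
rewrite expnMn leq_mul2r; apply/orP; right.
have pleN : (p <= N)%N by apply: leq_ltn_trans pN; rewrite leq_pmull.
have h2N (m : 'I_p) : (N + m < 2 * N)%N by have := ltn_ord m; lia.
pose emb (u : 'I_p * {ffun 'I_s -> 'I_p}) : 'I_N * {ffun 'I_s -> 'I_(2 * N)} :=
  (widen_ord pleN u.1, [ffun i => Ordinal (h2N (u.2 i))]).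
have emb_inj : injective emb.
  move=> [x h] [y k] [/= exy /ffunP ehk]; congr (_, _); first exact/val_inj.
  apply/ffunP => i; have := ehk i; rewrite !ffunE => /(congr1 val) /= e.
  by apply/val_inj => /=; lia.
rewrite /card_Pi pair_big_dep /= sum1_card.
have -> : (p ^ s.+1 = #|{: 'I_p * {ffun 'I_s -> 'I_p}}|)%N.
  by rewrite card_prod card_ffun !card_ord expnS.
rewrite -cardsT -(card_imset _ emb_inj); apply: subset_leq_card.
apply/fintype.subsetP => _ /imsetP [[x h] _ ->].
rewrite unfold_in /=; apply/forallP => w.
have -> : cube_point (widen_ord pleN x) [ffun i => Ordinal (h2N (h i))] w =
    (wsum w x (fun i => h i : nat))%:Z.
  rewrite /cube_point /wsum PoszD; congr (_ + _).
  rewrite (big_morph Posz PoszD (erefl _)); apply: eq_bigr => i _.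
  by rewrite ffunE /=; lia.
rewrite lez_nat /= ltz_nat; apply: leq_ltn_trans pN.
by apply: wsum_le => // i.
Qed.

Section UpperBound.
Variable R : realType.
Implicit Types (F G : int -> R[i]) (f : nat -> R[i]).

Lemma gowers_powE s N f :
  gowers_pow s N f = (card_Pi s N)%:R^-1 * gsum s N (cutoff N f).
Proof.
rewrite /gowers_pow /gsum; congr (_ * _); apply: eq_bigr => x _.
rewrite big_mkcond; apply: eq_bigr => h _; rewrite /dprod.
case: ifPn => [/forallP hP|].
  by apply: eq_bigr => w _; rewrite /cutoff; have := hP w; rewrite /cube_point => ->.
rewrite negb_forall => /existsP [w nw]; rewrite (bigD1 w) //= cutoff_supported //.
by rewrite conj_pow0 mul0r.
Qed.

Lemma cutoff_le1 N f y : unimodular f -> cabs (cutoff N f y) <= 1.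
Proof.
by move=> f1; rewrite /cutoff; case: ifP => _; rewrite ?cabs0 ?unimodularP.
Qed.

Lemma sum_cutoffB N' N f (c : int) : unimodular f -> (N' <= N)%N ->
  \sum_(x < N) cabs (cutoff N f (x%:Z + c) - cutoff N' f (x%:Z + c)) <= (N - N')%:R.
Proof.
move=> f1 leN.
pose phi y := cabs (cutoff N f y - cutoff N' f y).
have phi0 y : ~~ ((N'%:Z <= y) && (y < N'%:Z + (N - N')%:Z)) -> phi y = 0.
  rewrite /phi /cutoff => ny; have -> : (y < N%:Z) = (y < N'%:Z) || (N%:Z <= y) && (y < N%:Z).
    lia.
  have -> : (N%:Z <= y) && (y < N%:Z) = false by lia.
  by rewrite orbF subrr cabs0.
have phi1 y : phi y <= 1.
  have [ny|] := boolP ((N'%:Z <= y) && (y < N'%:Z + (N - N')%:Z)); last first.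
    by move/phi0 => ->.
  rewrite /phi {2}/cutoff; have -> : (y < N'%:Z) = false by lia.
  by rewrite andbF subr0 cutoff_le1.
have [k kE] : exists k, k = (N + absz c)%N by exists (N + absz c)%N.
have -> : (N - N')%:R = \sum_(b < N - N') (1 : R) by rewrite sumr_const card_ord.
apply: (@le_trans _ _ (\sum_(b < N - N') phi (b%:Z + N'%:Z))); last first.
  by apply: ler_sum.
(* Enlarging the range by [k] on both sides makes it cover [[N', N)] whatever the shift [c]; the
   added terms are nonnegative. *)
have <- := @sum_supported _ phi (k + (N + k))%N _ _ (c - k%:Z) phi0 _ _; try lia.
rewrite !big_split_ord /=; apply: (@le_trans _ _ (0 + (\sum_(x < N) phi ((k + x)%N%:Z + (c - k%:Z)) + 0))).
  rewrite add0r addr0; apply: eq_ler; apply: eq_bigr => x _.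
  by rewrite -/(phi _); congr phi; lia.
by apply: lerD; [|apply: lerD]; rewrite ?lexx ?sumr_ge0 // => *; exact: cabs_ge0.
Qed.

(** Telescoping over the [2 ^ s] vertices, and for each vertex and each choice of steps summing over
    the base point, gives at most [N - N']. *)
Lemma gsum_cutoffB s N' N f : unimodular f -> (N' <= N)%N ->
  cabs (gsum s N (cutoff N f) - gsum s N (cutoff N' f)) <=
  2 ^+ s * (2 * N)%:R ^+ s * (N - N')%:R.
Proof.
move=> f1 leN; rewrite /gsum -sumrB.
apply: le_trans (cabs_sum_le _ _ _) _.
apply: (@le_trans _ _ (\sum_(x < N) \sum_(h : {ffun 'I_s -> 'I_(2 * N)})
   \sum_(w : {ffun 'I_s -> bool})
     cabs (cutoff N f (x%:Z + \sum_(i | w i) ((h i)%:Z - N%:Z)) -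
           cutoff N' f (x%:Z + \sum_(i | w i) ((h i)%:Z - N%:Z))))).
  apply: ler_sum => x _; rewrite -sumrB; apply: le_trans (cabs_sum_le _ _ _) _.
  apply: ler_sum => h _; rewrite /dprod.
  apply: le_trans (cabs_prodB _ _ _) _ => [w|w|]; rewrite ?cabs_conj_pow ?cutoff_le1 //.
  by apply: ler_sum => w _; rewrite -conj_powB cabs_conj_pow.
rewrite exchange_big; under eq_bigr => h _ do rewrite exchange_big.
apply: (@le_trans _ _ (\sum_(h : {ffun 'I_s -> 'I_(2 * N)})
   \sum_(w : {ffun 'I_s -> bool}) (N - N')%:R)).
  by apply: ler_sum => h _; apply: ler_sum => w _; exact: sum_cutoffB.
rewrite !sumr_const !card_ffun card_bool !card_ord -mulrnA -[leLHS]mulr_natl.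
by rewrite natrM !natrX.
Qed.

(** As the cutoff length is a multiple of [Q], membership in the range depends only on the quotient
    by [Q], for negative arguments too. *)
Lemma cutoff_digit Q a f (k : int) (m : nat) : (0 < Q)%N ->
  (forall c b, (c < Q)%N -> f (c + Q * b)%N = f c * f (Q * b)%N) ->
  cutoff (Q * a) f (Q%:Z * k + m%:Z) =
  f (m %% Q)%N * cutoff a (dilate Q f) (k + (m %/ Q)%:Z).
Proof.
move=> Q0 fM; set l := k + _.
have -> : Q%:Z * k + m%:Z = Q%:Z * l + (m %% Q)%:Z.
  by rewrite {1}(divn_eq m Q) /l; rewrite mulrDr -addrA PoszD PoszM (mulrC Q%:Z (m %/ Q)%:Z).
have ltm : (m %% Q < Q)%N by exact: ltn_pmod.
move: (m %% Q)%N ltm => c ltc; rewrite /cutoff.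
have -> : (0 <= Q%:Z * l + c%:Z) = (0 <= l).
  by clearbody l; apply/idP/idP => h; nia.
case: l => l /=; last by rewrite mulr0.
have -> : Q%:Z * l%:Z + c%:Z = (Q * l + c)%N%:Z by rewrite PoszD PoszM.
rewrite !ltz_nat.
have -> : (Q * l + c < Q * a)%N = (l < a)%N by apply/idP/idP; nia.
case: ifP => _; last by rewrite mulr0.
by rewrite addnC fM.
Qed.

(** With the high parts [X], [H] fixed, the sum over low digits is a transfer with zero incoming
    carry. The high parts enter only through [Psi], and there are [a * (2 * a) ^ s] of them. *)
Lemma gsum_cutoff_transfer s Q a f (rho : R) : (0 < Q)%N -> unimodular f ->
  (forall c b, (c < Q)%N -> f (c + Q * b)%N = f c * f (Q * b)%N) ->
  (forall Psi, @carry_bounded R s 1 Psi -> carry_bounded rho (transfer Q f Psi)) ->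
  cabs (gsum s (Q * a) (cutoff (Q * a) f)) <= (a * (2 * a) ^ s)%:R * rho.
Proof.
move=> Q0 f1 fM hrho.
have -> : gsum s (Q * a) (cutoff (Q * a) f) = bsum (Q * a) (Q * (2 * a)) (fun x (h : 'I_s -> nat) =>
    dprod (cutoff (Q * a) f) x%:Z (fun i => (h i)%:Z - (Q * a)%:Z)).
  by rewrite (mulnCA Q 2 a).
rewrite bsum_digit; apply: cabs_bsum_le => X H _ _.
pose kap (w : {ffun 'I_s -> bool}) := X%:Z + \sum_(i | w i) ((H i)%:Z - a%:Z).
pose Psi (r : {ffun 'I_s -> bool} -> nat) :=
  \prod_w conj_pow (weight w) (cutoff a (dilate Q f) (kap w + (r w)%:Z)).
have -> : bsum Q Q (fun y (k : 'I_s -> nat) => dprod (cutoff (Q * a) f)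
    (Q * X + y)%N%:Z (fun i => (Q * H i + k i)%N%:Z - (Q * a)%:Z)) =
    transfer Q f Psi (fun=> 0%N).
  apply: eq_bsum => y k _ _; rewrite /dprod -big_split; apply: eq_bigr => w _ /=.
  rewrite -conj_powM addn0; congr conj_pow; rewrite -cutoff_digit //; congr cutoff.
  rewrite /kap /wsum !PoszD mulrDr PoszM big_distrr /=.
  rewrite (big_morph Posz PoszD (erefl _)) -!addrA; congr (_ + _).
  rewrite addrCA -big_split /=; congr (_ + _); apply: eq_bigr => i _.
  by rewrite !PoszD !PoszM; ring.
apply: hrho => // r _; rewrite /Psi cabs_prod prodr_ile1 // => w _.
rewrite cabs_ge0 cabs_conj_pow cutoff_le1 // => n; rewrite /dilate; exact: f1.
Qed.

(** Truncating [N] to a multiple of [Q] loses at most [Q] points, hence the term [Q / N]. The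
    constant comes from [card_Pi_ge], the number of vertices and the range [2 * N] of the steps. *)
Lemma gowers_pow_le s Q N f (E : R) : (0 < Q)%N -> (0 < N)%N -> unimodular f ->
  (forall c b, (c < Q)%N -> f (c + Q * b)%N = f c * f (Q * b)%N) ->
  (forall Psi, @carry_bounded R s 1 Psi ->
     carry_bounded (Q%:R ^+ s.+1 * E) (transfer Q f Psi)) ->
  0 <= E ->
  cabs (gowers_pow s N f) <= s.+1%:R ^+ s.+1 * 2 ^+ s * 2 ^+ s * (Q%:R / N%:R + E).
Proof.
move=> Q0 N0 f1 fM hE E0; rewrite gowers_powE cabsM cabsV cabs_nat.
have NR : 0 < N%:R :> R by rewrite ltr0n.
set a := (N %/ Q)%N.
have QaN : (Q * a <= N)%N by rewrite mulnC leq_trunc_div.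
have NQa : (N - Q * a <= Q)%N.
  by have := ltn_ceil N Q0; rewrite -/a mulSn mulnC; lia.
have cge : N%:R ^+ s.+1 <= (card_Pi s N)%:R * s.+1%:R ^+ s.+1 :> R.
  by rewrite -!natrX -natrM ler_nat card_Pi_ge.
have c0 : 0 < (card_Pi s N)%:R :> R.
  rewrite ltr0n lt0n; apply/eqP => c0; move: cge; rewrite c0 mul0r.
  by rewrite leNgt exprn_gt0.
rewrite mulrC ler_pdivrMr //.
have step1 : cabs (gsum s N (cutoff N f)) <=
  2 ^+ s * 2 ^+ s * (N%:R ^+ s * Q%:R + N%:R ^+ s.+1 * E).
  rewrite mulrDr; apply: le_trans (cabs_rev _ (gsum s N (cutoff (Q * a) f))) _.
  rewrite addrC; apply: lerD.
    apply: le_trans (gsum_cutoffB _ f1 QaN) _.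
    rewrite natrM exprMn -!mulrA !ler_wpM2l ?exprn_ge0 ?ler0n ?ler_nat //.
  rewrite (@gsum_shrink _ s (Q * a) N) //; last exact: cutoff_supported.
  apply: le_trans (gsum_cutoff_transfer _ Q0 f1 fM hE) _.
  rewrite mulrA [leRHS]mulrA; apply: (ler_wpM2r E0); rewrite natrM natrX natrM exprMn.
  have -> : a%:R * (2%:R ^+ s * a%:R ^+ s) * Q%:R ^+ s.+1 = 2 ^+ s * (Q * a)%:R ^+ s.+1 :> R.
    by rewrite natrM exprMn !exprS; ring.
  apply: ler_pM; rewrite ?exprn_ge0 //.
    by rewrite ler_peMl ?exprn_ge0 // exprn_ege1 // ler1n.
  by rewrite lerXn2r ?nnegrE // ler_nat.
apply: le_trans step1 _.
have -> : N%:R ^+ s * Q%:R + N%:R ^+ s.+1 * E = N%:R ^+ s.+1 * (Q%:R / N%:R + E) :> R.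
  by rewrite exprS; field; exact: lt0r_neq0.
have QN0 : 0 <= Q%:R / N%:R + E by rewrite addr_ge0 // divr_ge0.
apply: (@le_trans _ _ (2 ^+ s * 2 ^+ s * ((card_Pi s N)%:R * s.+1%:R ^+ s.+1 * (Q%:R / N%:R + E)))).
  by rewrite ler_wpM2l ?mulr_ge0 ?exprn_ge0 // ler_wpM2r.
by apply: eq_ler; ring.
Qed.

End UpperBound.

(** * Correlation with a linear phase *)

Definition cis (R : realType) (x : R) : R[i] := (cos x +i* sin x)%C.

Section Roots.
Variable R : realType.
Implicit Types (w v y : R[i]) (x : R).

Lemma cisD (x1 x2 : R) : cis (x1 + x2) = cis x1 * cis x2.
Proof. by rewrite /cis cosD sinD; simpc; rewrite (addrC (sin x1 * _)). Qed.

Lemma cis0 : cis (0 : R) = 1.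
Proof. by rewrite /cis cos0 sin0. Qed.

Lemma cisMn n x : cis (n%:R * x) = cis x ^+ n.
Proof.
elim: n => [|n IHn]; first by rewrite mul0r cis0.
by rewrite exprS -IHn -cisD -natr1; congr cis; ring.
Qed.

Lemma cabs_cis x : cabs (cis x) = 1.
Proof. by rewrite /cabs /= cos2Dsin2 sqrtr1. Qed.

Lemma cabs_1B_cis x : cabs (1 - cis x) ^+ 2 = 2 - 2 * cos x.
Proof.
by have := Re_unimodular (cabs_cis x); rewrite /= => h; lra.
Qed.

Lemma polar w : cabs w = 1 -> exists2 x : R, `|x| <= pi & w = cis x.
Proof.
case: w => a b w1; have := sqr_cabs (a +i* b)%C; rewrite w1 expr1n /= => ab.
have b2 := sqr_ge0 b; have a1 : -1 <= a <= 1.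
  by rewrite -ler_norml -(@expr_le1 _ 2) // real_normK ?num_real //; lra.
have x0 := acos_ge0 a1; have xpi := acos_lepi a1.
have cosx : cos (acos a) = a by rewrite acosK.
have sinx : sin (acos a) = `|b|.
  by rewrite sin_acos // (_ : 1 - a ^+ 2 = b ^+ 2) ?sqrtr_sqr //; lra.
have [b0|b0] := leP 0 b.
  by exists (acos a); rewrite ?ger0_norm // /cis cosx sinx ger0_norm.
exists (- acos a); first by rewrite normrN ger0_norm.
by rewrite /cis cosN sinN cosx sinx ltr0_norm // opprK.
Qed.

(* Dividing the argument by [q >= 2] contracts the distance to [1]. *)
Lemma near_root q w : (1 < q)%N -> cabs w = 1 ->
  exists v, [/\ v ^+ q = w, cabs v = 1 & cabs (1 - v) ^+ 2 <= cabs (1 - w) ^+ 2 / 2].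
Proof.
move=> q1 /polar [x xpi ->]; exists (cis (x / q%:R)).
have q2 : 2 <= q%:R :> R by rewrite ler_nat.
split; [|exact: cabs_cis|].
  by rewrite -cisMn; congr cis; field; lra.
(* With [c = cos (z / 2)] in [[0, 1]], the claim reduces to [2 - 2 * c <= 2 - 2 * c ^+ 2]. *)
rewrite !cabs_1B_cis -(cos_norm x) -(cos_norm (x / _)) normrM normfV.
rewrite (@ger0_norm _ q%:R) //; set z := `|x| in xpi *.
have z0 : 0 <= z by exact: normr_ge0.
have zq : z / q%:R <= z / 2.
  by rewrite ler_wpM2l // lef_pV2 // posrE; lra.
have zq0 : 0 <= z / q%:R by rewrite divr_ge0.
have pi0 := pi_gt0 R.
have c_le : cos (z / 2) <= cos (z / q%:R).
  by rewrite leNgt; apply/negP; rewrite ltr_cos ?in_itv /= ?zq0 //; lra.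
have c0 : 0 <= cos (z / 2) by apply: cos_ge0_pihalf; lra.
have c1 := cos_le1 (z / 2).
have -> : cos z = 2 * cos (z / 2) ^+ 2 - 1.
  by rewrite {1}(_ : z = z / 2 *+ 2) ?cos_mulr2n; lra.
have c2 : cos (z / 2) ^+ 2 <= cos (z / 2) by rewrite expr2 ler_piMl.
lra.
Qed.

Lemma sum_roots_of_unity q d : (0 < d < q)%N ->
  \sum_(j < q) (cis (2 * pi / q%:R) : R[i]) ^+ (d * j) = 0.
Proof.
move=> /andP [d0 dq]; set z := cis _.
have q0 : 0 < q%:R :> R by rewrite ltr0n; lia.
have dq' : d%:R < q%:R :> R by rewrite ltr_nat.
have d0' : 0 < d%:R :> R by rewrite ltr0n.
have pi0 := pi_gt0 R.
(* Otherwise [cos (2 * phi) = 1] for [phi = pi * (d / q)], although [phi] lies strictly between [0]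
   and [pi], where the sine is positive. *)
have zd : z ^+ d - 1 != 0.
  rewrite subr_eq0; apply/eqP => zd1.
  have := cabs_1B_cis (d%:R * (2 * pi / q%:R)); rewrite cisMn -/z zd1 subrr cabs0.
  pose phi : R := pi * (d%:R / q%:R).
  rewrite (_ : d%:R * (2 * pi / q%:R) = phi *+ 2); last by rewrite /phi mulr2n; field; lra.
  have r0 : 0 < d%:R / q%:R :> R by exact: divr_gt0.
  have r1 : d%:R / q%:R < 1 :> R by rewrite ltr_pdivrMr // mul1r.
  have : 0 < sin phi.
    by apply: sin_gt0_pi; rewrite /phi mulr_gt0 //= gtr_pMr.
  move=> sphi; have := cos2Dsin2 phi; have := exprn_gt0 2 sphi.
  rewrite cos_mulr2n expr0n /=; set A := cos phi ^+ 2; set B := sin phi ^+ 2.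
  by rewrite mulr2n; lra.
under eq_bigr => j _ do rewrite exprM.
apply: (mulfI zd); rewrite mulr0 -subrX1 -exprM mulnC exprM.
have -> : z ^+ q = 1.
  rewrite -cisMn (_ : q%:R * _ = pi *+ 2); last by rewrite mulr2n; field; lra.
  by rewrite /cis cos2pi sin2pi.
by rewrite expr1n subrr.
Qed.

(** Summed over all [q] roots [v * z ^+ j] of [w], the digit sums add up to [q * a 0], so some root
    reaches the average. *)
Lemma big_root q w (a : nat -> R[i]) : (1 < q)%N -> cabs w = 1 -> a 0%N = 1 ->
  exists y, [/\ y ^+ q = w, cabs y = 1 & 1 <= cabs (\sum_(d < q) a d * y ^+ d)].
Proof.
move=> q1 w1 a0; have q0 : (0 < q)%N by lia.
have q0' : q%:R != 0 :> R by rewrite pnatr_eq0; lia.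
have [v [vq v1 _]] := near_root q1 w1.
pose z : R[i] := cis (2 * pi / q%:R).
have [j hj] := exists_ge_avg (fun j : 'I_q =>
  cabs (\sum_(d < q) a d * (v * z ^+ j) ^+ d)) q0.
exists (v * z ^+ j); split.
- rewrite exprMn vq -exprM mulnC exprM.
  have -> : z ^+ q = 1.
    rewrite -cisMn (_ : q%:R * _ = pi *+ 2); last by rewrite mulr2n; field.
    by rewrite /cis cos2pi sin2pi.
  by rewrite expr1n mulr1.
- by rewrite cabsM cabsX cabs_cis v1 expr1n mulr1.
rewrite -(@ler_pM2l _ q%:R) ?ltr0n // mulr1; apply: le_trans hj.
apply: le_trans (cabs_sum_le _ _ _).
rewrite exchange_big /=.
rewrite (bigD1 (Ordinal q0)) //= [X in _ + X]big1 ?addr0; last first.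
  move=> d nd; under eq_bigr => k _ do rewrite exprMn -exprM mulnC mulrA.
  rewrite -big_distrr /= sum_roots_of_unity ?mulr0 //.
  by rewrite ltn_ord lt0n andbT; apply: contra nd => /eqP d0; apply/eqP/val_inj.
under eq_bigr => k _ do rewrite expr0 mulr1 a0.
by rewrite sumr_const card_ord cabs_nat.
Qed.

(** Unless [v = 1], the modulus of the geometric sum is the quotient of the two distances to [1]. *)
Lemma geometric_ge1 q v : (1 < q)%N -> cabs v = 1 ->
  cabs (1 - v) <= cabs (1 - v ^+ q) -> 1 <= cabs (\sum_(d < q) v ^+ d).
Proof.
move=> q1 v1 le1; have [v_eq1|nv] := eqVneq v 1.
  rewrite v_eq1; under eq_bigr => d _ do rewrite expr1n.
  by rewrite sumr_const card_ord cabs_nat ler1n; lia.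
have pos : 0 < cabs (1 - v).
  rewrite lt0r cabs_ge0 andbT; apply/eqP => /Normc.eq0_normc /eqP.
  by rewrite subr_eq0 eq_sym (negbTE nv).
rewrite -(ler_pM2l pos) mulr1; apply: le_trans le1 _.
rewrite -[X in X * _]cabsN opprB -cabsM -subrX1 -[leRHS]cabsN opprB //.
Qed.

Lemma cabs_1BX d v : cabs v = 1 -> cabs (1 - v ^+ d) <= d%:R * cabs (1 - v).
Proof.
move=> v1; elim: d => [|d IHd]; first by rewrite subrr cabs0 mul0r.
rewrite exprS -natr1 mulrDl mul1r [leRHS]addrC.
by apply: le_trans (cabs_1BM _ v1) _; rewrite lerD2l.
Qed.

End Roots.

(** * Choice of one digit of the frequency *)

Section LocalStep.
Variables (R : realType) (q : nat) (g : nat -> R[i]) (eps : R).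
Hypotheses (q1 : (1 < q)%N) (g1 : forall n, cabs (g n) = 1) (g0 : g 0%N = 1).
Hypothesis small : forall n, (n < q)%N -> cabs (1 - iter 2 (mdiff 1) g n) <= eps.

Let u := g 1%N.

Lemma local_eps_ge0 : 0 <= eps.
Proof. by apply: le_trans (small (ltnW q1)); rewrite cabs_ge0. Qed.

(** The slope starts at [conjc u] and drifts by at most [eps] per step. *)
Lemma mdiff_near n : (n <= q)%N -> cabs (mdiff 1 g n - conjc u) <= n%:R * eps.
Proof.
elim: n => [_|n IHn ltn]; first by rewrite /mdiff g0 mul1r subrr cabs0 mul0r.
apply: le_trans (cabs_dist _ (mdiff 1 g n) _) _.
rewrite -natr1 mulrDl mul1r addrC; apply: lerD; first by apply: IHn; lia.
have m1 := mdiff_unim 1 g1.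
have := small ltn; rewrite iterS /=; apply: le_trans.
rewrite -[leRHS]mul1r -(m1 n.+1) -cabsM mulrBr mulr1.
rewrite -[mdiff 1 (mdiff 1 g) n]/(mdiff 1 g n * conjc (mdiff 1 g (n + 1)%N)) addn1.
by rewrite mulrCA unimodular_conj // mulr1.
Qed.

Lemma linear_near d : (d <= q)%N -> cabs (g d - u ^+ d) <= (d * q)%:R * eps.
Proof.
elim: d => [_|d IHd led]; first by rewrite g0 subrr cabs0 mul0r.
have E : g d.+1 = g d * conjc (mdiff 1 g d).
  by rewrite /mdiff rmorphM /= conjcK mulrA unimodular_conj // mul1r addn1.
have -> : g d.+1 - u ^+ d.+1 = g d * (conjc (mdiff 1 g d) - u) + (g d - u ^+ d) * u.
  by rewrite E exprSr; ring.
rewrite mulSn natrD [leRHS]mulrDl; apply: le_trans (cabs_le_add _ _) _.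
rewrite !cabsM /u !g1 mul1r mulr1; apply: lerD; last by apply: IHd; lia.
rewrite -cabs_conj rmorphB /= conjcK; apply: le_trans (mdiff_near _) _; first by lia.
by rewrite ler_wpM2r ?local_eps_ge0 // ler_nat; lia.
Qed.

Let c4 : R := 16 * q%:R ^+ 6.
Let c5 : R := 4 * q%:R ^+ 7.

(** Here [y'] is the frequency already chosen for the higher digits, which forces [y ^+ q = y']. The
    slope error [cabs (1 - y * u)] contracts up to [eps], while the digit sum stays close to its
    maximal size [q]. *)
Lemma local_step (y' : R[i]) : cabs y' = 1 -> exists y, [/\ y ^+ q = y', cabs y = 1,
  cabs (1 - y * u) ^+ 2 <= 3 / 4 * cabs (1 - y' * g q) ^+ 2 + c4 * eps ^+ 2 &
  q%:R * expR (- (c5 * (cabs (1 - y * u) ^+ 2 + eps ^+ 2))) <=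
    cabs (\sum_(d < q) g d * y ^+ d)].
Proof.
move=> y1'; have e0 := local_eps_ge0; set Q : R := q%:R.
have Q2 : 2 <= Q by rewrite ler_nat.
have Q0 : 0 < Q by lra.
(* If [2 * Q ^+ 3 * eps > 1], the terms in [eps ^+ 2] dominate and a digit sum of at least [1]
   suffices. Otherwise the total error [Q ^+ 3 * eps] of the [q] summands is at most [1 / 2]. *)
have [bad|good] := ltP 1 (2 * Q ^+ 3 * eps).
  have [y [yq y1 P1]] := big_root q1 y1' g0; exists y; split => //.
    have : cabs (1 - y * u) ^+ 2 <= 4.
      have yu : cabs (y * u) = 1 by rewrite cabsM y1 g1 mulr1.
      have := cabs_1B_le2 yu; have := cabs_ge0 (1 - y * u); nra.
    have : 1 <= (2 * Q ^+ 3 * eps) ^+ 2 by rewrite exprn_ege1 // ltW.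
    have -> : (2 * Q ^+ 3 * eps) ^+ 2 = 4 * (Q ^+ 6 * eps ^+ 2) by ring.
    rewrite /c4 -/Q.
    have := sqr_ge0 (cabs (1 - y' * g q)); lra.
  apply: le_trans _ P1; set E := cabs _ ^+ 2.
  have E0 : 0 <= E by exact: sqr_ge0.
  have h : Q <= c5 * (E + eps ^+ 2).
    have : 1 <= (2 * Q ^+ 3 * eps) ^+ 2 by rewrite exprn_ege1 // ltW.
    have -> : (2 * Q ^+ 3 * eps) ^+ 2 = 2 ^+ 2 * Q ^+ 6 * eps ^+ 2 by ring.
    move=> h.
    have c50 : 0 <= c5 * E by rewrite mulr_ge0 // mulr_ge0 // exprn_ge0 // ltW.
    rewrite mulrDr; have -> : c5 * eps ^+ 2 = Q * (2 ^+ 2 * Q ^+ 6 * eps ^+ 2).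
      by rewrite /c5 -/Q; ring.
    have : Q * 1 <= Q * (2 ^+ 2 * Q ^+ 6 * eps ^+ 2) by rewrite ler_pM2l.
    lra.
  rewrite expRN -ler_pdivlMr ?invr_gt0 ?expR_gt0 // invrK mul1r.
  by have := expR_ge1Dx (c5 * (E + eps ^+ 2)); lra.
have w1 : cabs (y' * u ^+ q) = 1 by rewrite cabsM cabsX g1 expr1n mulr1.
have [v [vq v1 vle]] := near_root q1 w1.
(* The factor [conjc u] removes the slope of [g], so that [y * u = v]. *)
exists (v * conjc u).
have uu : u * conjc u = 1 by rewrite unimodular_conj // g1.
have yu : v * conjc u * u = v by rewrite -mulrA (mulrC _ u) uu mulr1.
rewrite yu; set E := cabs (1 - v) ^+ 2; set E' := cabs (1 - y' * g q) ^+ 2.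
(* Half of [(A' + B) ^+ 2 <= 3 / 2 * A' ^+ 2 + 3 * B ^+ 2], the halving being the gain of
   [near_root]. *)
have Ele : E <= 3 / 4 * E' + 3 / 2 * (Q ^+ 2 * eps) ^+ 2.
  apply: le_trans vle _.
  have h1 : cabs (1 - y' * u ^+ q) <= cabs (1 - y' * g q) + Q ^+ 2 * eps.
    apply: le_trans (cabs_dist _ (y' * g q) _) _; rewrite lerD2l -mulrBr cabsM y1' mul1r.
    by apply: le_trans (linear_near (leqnn q)) _; rewrite natrM -expr2.
  rewrite /E'; move: h1 (cabs_ge0 (1 - y' * u ^+ q)).
  set A := cabs (1 - y' * u ^+ q); set A' := cabs (1 - y' * g q); set B := Q ^+ 2 * eps => h1 A0.
  have : A ^+ 2 <= (A' + B) ^+ 2 by rewrite lerXn2r ?nnegrE //; lra.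
  have := sqr_ge0 (A' - 2 * B); rewrite !sqrrD; nra.
have Qe : (Q ^+ 2 * eps) ^+ 2 = Q ^+ 4 * eps ^+ 2 by ring.
have Q4 : Q ^+ 4 * eps ^+ 2 <= Q ^+ 6 * eps ^+ 2.
  by rewrite ler_wpM2r ?sqr_ge0 // ler_weXn2l //; lra.
split.
- by rewrite exprMn vq -mulrA -exprMn uu expr1n mulr1.
- by rewrite cabsM v1 cabs_conj g1 mulr1.
- have := sqr_ge0 (eps); have : 0 <= Q ^+ 6 * eps ^+ 2 by rewrite mulr_ge0 ?sqr_ge0 // exprn_ge0 // ltW.
  move: Ele; rewrite Qe /c4 -/Q; lra.
set P := \sum_(d < q) _; set X := Q ^+ 4 * eps ^+ 2 + Q ^+ 2 * E.
have E0 : 0 <= E by exact: sqr_ge0.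
have near (d : 'I_q) : cabs (g d * (v * conjc u) ^+ d - v ^+ d) <= Q ^+ 2 * eps.
  have -> : g d * (v * conjc u) ^+ d - v ^+ d = (g d - u ^+ d) * (v * conjc u) ^+ d.
    by rewrite mulrBl -exprMn mulrCA uu mulr1.
  rewrite cabsM cabsX cabsM v1 cabs_conj g1 mulr1 expr1n mulr1.
  apply: le_trans (linear_near _) _; first by have := ltn_ord d; lia.
  rewrite expr2 -natrM ler_wpM2r // ler_nat leq_mul2r; have := ltn_ord d; lia.
have Pge : 1 / 2 <= cabs P.
  have S1 : 1 <= cabs (\sum_(d < q) v ^+ d).
    apply: geometric_ge1 => //; rewrite vq.
    move: vle (cabs_ge0 (1 - v)) (cabs_ge0 (1 - y' * u ^+ q)).
    set A := cabs (1 - v); set A' := cabs _ => h hA hA'.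
    by rewrite -(@ler_sqr _ A A') ?nnegrE //; have := sqr_ge0 A'; lra.
  have : cabs (\sum_(d < q) v ^+ d - P) <= Q ^+ 3 * eps.
    rewrite /P -sumrB; apply: le_trans (cabs_sum_le _ _ _) _.
    apply: (@le_trans _ _ (\sum_(d < q) Q ^+ 2 * eps)).
      by apply: ler_sum => d _; rewrite cabs_distC near.
    by rewrite sumr_const card_ord -[leLHS]mulr_natl mulrA -exprS.
  have := cabs_rev (\sum_(d < q) v ^+ d) P; lra.
(* Each summand [x] has real part [1 - cabs (1 - x) ^+ 2 / 2], and [cabs (1 - x) ^+ 2 <= 2 * X]. *)
have Pge2 : Q * (1 - X) <= cabs P.
  apply: le_trans (Re_le_cabs P); rewrite /P raddf_sum /=.
  have -> : Q * (1 - X) = \sum_(d < q) (1 - X) by rewrite sumr_const card_ord mulr_natl.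
  apply: ler_sum => d _; rewrite Re_unimodular; last first.
    by rewrite cabsM cabsX cabsM v1 cabs_conj !g1 mulr1 expr1n mulr1.
  rewrite lerD2l lerN2 ler_pdivrMr //.
  set x := g d * _.
  have h : cabs (1 - x) <= Q * cabs (1 - v) + Q ^+ 2 * eps.
    apply: le_trans (cabs_dist _ (v ^+ d) _) _; apply: lerD.
      apply: le_trans (cabs_1BX _ v1) _; rewrite ler_wpM2r ?cabs_ge0 // ler_nat.
      by have := ltn_ord d; lia.
    by rewrite cabs_distC near.
  have : cabs (1 - x) ^+ 2 <= (Q * cabs (1 - v) + Q ^+ 2 * eps) ^+ 2.
    by rewrite lerXn2r ?nnegrE ?cabs_ge0 //; apply: le_trans h; exact: cabs_ge0.
  rewrite /X /E -Qe -exprMn.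
  have := sqr_ge0 (Q * cabs (1 - v) - Q ^+ 2 * eps); rewrite sqrrB sqrrD; lra.
have X0 : 0 <= X by rewrite addr_ge0 // mulr_ge0 ?sqr_ge0 // exprn_ge0 // ltW.
have XC : 4 * Q * X <= c5 * (E + eps ^+ 2).
  rewrite /X /c5 -/Q !mulrDr addrC; apply: lerD.
    have -> : 4 * Q * (Q ^+ 2 * E) = 4 * Q ^+ 3 * E by ring.
    by rewrite ler_wpM2r // ler_pM2l // ler_weXn2l //; lra.
  have -> : 4 * Q * (Q ^+ 4 * eps ^+ 2) = 4 * Q ^+ 5 * eps ^+ 2 by ring.
  by rewrite ler_wpM2r ?sqr_ge0 // ler_pM2l // ler_weXn2l //; lra.
apply: (@le_trans _ _ (Q * expR (- (4 * Q * X)))).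
  by rewrite ler_pM2l // ler_expR lerN2.
(* For small [X], [(1 - X) * (1 + 2 * X) >= 1] gives [1 - X >= expR (- (2 * X))]. For large [X], the
   bound [1 / 2] wins because [expR (4 * Q * X) >= 2 * Q]. *)
have [X2|X2] := leP X (1 / 2).
  apply: le_trans Pge2; rewrite ler_pM2l //.
  apply: (@le_trans _ _ (expR (- (2 * X)))).
    by rewrite ler_expR lerN2; nra.
  rewrite expRN -[leLHS]mul1r ler_pdivrMr ?expR_gt0 //.
  apply: (@le_trans _ _ ((1 - X) * (1 + 2 * X))); first by nra.
  by rewrite ler_wpM2l ?expR_ge1Dx //; lra.
apply: le_trans Pge; rewrite expRN ler_pdivrMr ?expR_gt0 //.
have : 1 + 4 * Q * X <= expR (4 * Q * X) by exact: expR_ge1Dx.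
have : Q * (1 / 2) <= Q * X by rewrite ler_pM2l // ltW.
lra.
Qed.

End LocalStep.

(** Since [y ^+ q = y'], the exponential sum over [n < q ^ L] factors into the lowest digit sum and
    the sum for the next level. The induction on [L] keeps [t] free, so the top digit is treated
    first. *)
Lemma fourier_lower (R : realType) (q : nat) (f : nat -> R[i]) (eps : nat -> R) :
  (1 < q)%N -> unimodular f -> q_multiplicative q f ->
  (forall t n, (n < q)%N ->
    cabs (1 - iter 2 (mdiff 1) (dilate (q ^ t) f) n) <= eps t) ->
  forall L, exists2 y, cabs y = 1 &
    (q ^ L)%:R * expR (- (1000 * q%:R ^+ 13 * \sum_(t < L) eps t ^+ 2)) <=
      cabs (\sum_(n < q ^ L) f n * y ^+ n).
Proof.
move=> q1 f1 fM small; set C1 : R := 1000 * q%:R ^+ 13.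
(* The solution of [3 / 4 * (c3 + 4 * q ^ 7) = c3]: the contraction in [local_step] then covers both
   its own loss and the new potential. *)
pose c3 : R := 12 * q%:R ^+ 7.
have Q1 : 1 <= q%:R :> R by rewrite ler1n ltnW.
have c30 : 0 <= c3 by rewrite mulr_ge0 // exprn_ge0.
have q0 : (0 < q)%N by lia.
have [g1 g0] : (forall k n, cabs (dilate k f n) = 1) /\ (forall k, dilate k f 0%N = 1).
  split=> [k n|k]; first by rewrite /dilate unimodularP.
  by rewrite /dilate muln0 (q_mult0 f1 fM).
(* The term [c3 * cabs (1 - y * f (q ^ t)) ^+ 2] is the potential that pays for
   the drift of the frequency between consecutive digits. *)
suff H L : forall t, exists2 y, cabs y = 1 &
    (q ^ L)%:R * expR (- (C1 * \sum_(k < L) eps (t + k)%N ^+ 2) +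
        c3 * cabs (1 - y * dilate (q ^ t) f 1) ^+ 2) <=
      cabs (\sum_(n < q ^ L) dilate (q ^ t) f n * y ^+ n).
  move=> L; have [y y1 hy] := H L 0%N; exists y => //.
  have -> : \sum_(n < q ^ L) f n * y ^+ n = \sum_(n < q ^ L) dilate (q ^ 0) f n * y ^+ n.
    by apply: eq_bigr => n _; rewrite /dilate mul1n.
  apply: le_trans hy; rewrite ler_wpM2l // ler_expR lerDl.
  by rewrite mulr_ge0 // sqr_ge0.
elim: L => [|L IHL] t.
  (* With no digits left the sum is [1], so the potential must vanish, as it does at this
     frequency. *)
  exists (conjc (dilate (q ^ t) f 1)); first by rewrite cabs_conj.
  rewrite (mulrC (conjc _)) unimodular_conj // subrr cabs0 big_ord0 expn0 big_ord1 g0.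
  rewrite [X in cabs (1 * X)](_ : _ = 1) // mulr1 cabs1 expr0n /=.
  by rewrite !mulr0 oppr0 addr0 expR0 mulr1.
have [y' y1' hy'] := IHL t.+1.
have [y [yq y1 hE hP]] := local_step q1 (g1 (q ^ t)%N) (g0 _) (small t) y1'.
exists y => //; set g := dilate (q ^ t) f in hE hP *.
set E := cabs (1 - y * g 1%N) ^+ 2 in hE hP *.
have gq n : dilate (q ^ t.+1) f n = g (q * n)%N by rewrite /g /dilate expnSr mulnA.
have gq1 : dilate (q ^ t.+1) f 1 = g q by rewrite gq muln1.
rewrite gq1 in hy'; set E' := cabs (1 - y' * g q) ^+ 2 in hE hy'.
have -> : \sum_(n < q ^ L.+1) g n * y ^+ n =
    (\sum_(d < q) g d * y ^+ d) * \sum_(n < q ^ L) dilate (q ^ t.+1) f n * y' ^+ n.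
  rewrite expnS (big_digit _ _ (fun n => g n * y ^+ n)) mulrC big_distrl.
  apply: eq_bigr => k _; rewrite big_distrr; apply: eq_bigr => m _ /=.
  have := @q_mult_dilate R q f t 1 m k q0 fM; rewrite expn1 => /(_ (ltn_ord m)).
  rewrite -/g addnC => ->; rewrite gq exprD exprM yq; ring.
rewrite cabsM expnS natrM; set S := cabs (\sum_(n < q ^ L) _) in hy' *.
apply: le_trans (ler_pM _ _ hP hy'); try by rewrite mulr_ge0 // expR_ge0.
rewrite [leRHS]mulrACA -expRD ler_wpM2l ?mulr_ge0 // ler_expR.
rewrite big_ord_recl addn0.
under eq_bigr => k _ do rewrite /= /bump add1n addnS -addSn.
set Sig := \sum_(k < L) _; set e2 := eps t ^+ 2 in hE *.
have e20 : 0 <= e2 by exact: sqr_ge0.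
have E0 : 0 <= E by exact: sqr_ge0.
have : c3 * E <= c3 * (3 / 4 * E' + 16 * q%:R ^+ 6 * e2) by rewrite ler_wpM2l.
have h7 : q%:R ^+ 7 * e2 <= q%:R ^+ 13 * e2.
  by rewrite ler_wpM2r // ler_weXn2l.
have -> : c3 * (3 / 4 * E' + 16 * q%:R ^+ 6 * e2) =
    9 * q%:R ^+ 7 * E' + 192 * (q%:R ^+ 13 * e2) by rewrite /c3; field.
rewrite /C1 /c3; have : 0 <= q%:R ^+ 13 * e2 by rewrite mulr_ge0 // exprn_ge0.
rewrite !mulrDr; lra.
Qed.

(** * Lower bound for the second Gowers norm *)

Lemma sqr_sum_le (R : realType) n (x : 'I_n -> R) :
  (\sum_i x i) ^+ 2 <= n%:R * \sum_i x i ^+ 2.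
Proof.
case: n x => [|n] x; first by rewrite !big_ord0 expr0n mulr0.
set S := \sum_i x i; set N : R := n.+1%:R.
have N0 : 0 < N by rewrite ltr0n.
have : 0 <= \sum_i (N * x i - S) ^+ 2 by apply: sumr_ge0 => i _; exact: sqr_ge0.
have -> : \sum_i (N * x i - S) ^+ 2 = N * (N * (\sum_i x i ^+ 2) - S ^+ 2).
  transitivity (\sum_i (N ^+ 2 * x i ^+ 2 + ((- (2 * N * S)) * x i + S ^+ 2))).
    by apply: eq_bigr => i _; ring.
  rewrite !big_split /= -!big_distrr /= sumr_const card_ord -mulr_natl -/N -/S.
  by ring.
by rewrite pmulr_rge0 // subr_ge0.
Qed.

Definition autocorr (R : realType) (N : nat) (f : nat -> R[i]) (d : int) : R[i] :=
  \sum_(x < N) cutoff N f x%:Z * conjc (cutoff N f (x%:Z + d)).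

Section LowerBound.
Variable R : realType.
Implicit Types (f : nat -> R[i]) (y : R[i]).

(** One differencing leaves a first-order average for each step [a], and that is a square by
    [gsum_square] with no remaining steps. *)
Lemma gsum2E N f : gsum 2 N (cutoff N f) =
  (\sum_(a < 2 * N) cabs (autocorr N f (a%:Z - N%:Z)) ^+ 2)%:C%C.
Proof.
rewrite gsum_diff rmorph_sum; apply: eq_bigr => a _ /=.
rewrite gsum_square => [|y ny]; last by rewrite cutoff_supported ?mul0r.
congr (_%:C)%C.
pose h0 : {ffun 'I_0 -> 'I_(2 * N)} := [ffun i => a].
rewrite (big_pred1 h0) => [|h]; last by apply/esym/eqP/ffunP => -[].
congr (cabs _ ^+ 2); apply: eq_bigr => x _; rewrite /dprod.
rewrite (big_pred1 [ffun=> false]) => [|w]; last by apply/esym/eqP/ffunP => -[].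
rewrite big1 => [|[]] //; rewrite /weight eq_card0 ?addr0 // => -[] //.
Qed.

(** A linear phase multiplies the autocorrelation by a unimodular constant depending only on [d].
    Thus a correlation with any linear phase can be treated as a large plain sum. *)
Lemma autocorr_twist N f y d : cabs y = 1 ->
  cabs (autocorr N (fun n => f n * y ^+ n) d) = cabs (autocorr N f d).
Proof.
move=> y1; have yy := unimodular_conj y1.
pose c : R[i] := if 0 <= d then conjc y ^+ absz d else y ^+ absz d.
have c1 : cabs c = 1 by rewrite /c; case: ifP => _; rewrite cabsX ?cabs_conj y1 expr1n.
have -> : autocorr N (fun n => f n * y ^+ n) d = c * autocorr N f d.
  rewrite /autocorr big_distrr; apply: eq_bigr => x _ /=.
  rewrite /cutoff; case: ifP => [hx|_]; last by rewrite !mul0r mulr0.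
  case: ifP => [hxd|_]; last by rewrite rmorph0 !mulr0.
  rewrite /= rmorphM rmorphXn /= /c; case: ifPn => hd.
    have -> : absz (x%:Z + d) = (x + absz d)%N by lia.
    rewrite exprD -[LHS]mulr1 -[RHS]mulr1.
    rewrite (_ : f x * y ^+ x * (conjc (f (x + absz d)%N) * (conjc y ^+ x * conjc y ^+ absz d)) =
      (y * conjc y) ^+ x * (conjc y ^+ absz d * (f x * conjc (f (x + absz d)%N)))).
      by rewrite yy expr1n mul1r.
    by rewrite exprMn; ring.
  have xE : nat_of_ord x = addn (absz (x%:Z + d)) (absz d) by lia.
  set k := absz (x%:Z + d) in xE *.
  rewrite {2}xE exprD.
  rewrite (_ : f x * (y ^+ k * y ^+ absz d) * (conjc (f k) * conjc y ^+ k) =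
    (y * conjc y) ^+ k * (y ^+ absz d * (f x * conjc (f k)))).
    by rewrite yy expr1n mul1r.
  by rewrite exprMn; ring.
by rewrite cabsM c1 mul1r.
Qed.

Let window N m f (x : int) : R[i] := \sum_(n < m) cutoff N f (x + n%:Z).

(* The window sums are the convolution of [f] with an interval, so their energy
   is a correlation of two autocorrelations. *)
Lemma window_energy N m f : (m <= N)%N ->
  \sum_(a < 2 * N) cabs (window N m f (a%:Z - N%:Z)) ^+ 2 <=
  m%:R * \sum_(a < 2 * N) cabs (autocorr N f (a%:Z - N%:Z)).
Proof.
move=> lemN; set W := \sum_(a < _) _.
have W0 : 0 <= W by apply: sumr_ge0 => i _; exact: sqr_ge0.
have WE : (W%:C)%C = \sum_(n < m) \sum_(k < m) autocorr N f (k%:Z - n%:Z).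
  rewrite rmorph_sum /=.
  under eq_bigr => a _ do rewrite -mul_conjc /window rmorph_sum big_distrl /=.
  rewrite exchange_big; apply: eq_bigr => n _.
  under eq_bigr => a _ do rewrite big_distrr /=.
  rewrite exchange_big; apply: eq_bigr => k _.
  pose G z := cutoff N f z * conjc (cutoff N f (z + (k%:Z - n%:Z))).
  transitivity (\sum_(a < 2 * N) G (a%:Z + (n%:Z - N%:Z))).
    by apply: eq_bigr => a _; rewrite /G; congr (cutoff _ _ _ * conjc (cutoff _ _ _)); lia.
  rewrite (@sum_supported _ G _ N 0).
  - by apply: eq_bigr => x _; rewrite addr0.
  - by move=> z nz; rewrite /G cutoff_supported ?mul0r // -[N%:Z]add0r.
  - by have := ltn_ord n; lia.
  - by have := ltn_ord n; lia.
have -> : W = cabs (W%:C)%C.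
  by rewrite /cabs /= expr0n addr0 sqrtr_sqr ger0_norm.
rewrite WE; apply: le_trans (cabs_sum_le _ _ _) _.
have -> : m%:R * \sum_(a < 2 * N) cabs (autocorr N f (a%:Z - N%:Z)) =
   \sum_(n < m) \sum_(a < 2 * N) cabs (autocorr N f (a%:Z - N%:Z)).
  by rewrite sumr_const card_ord mulr_natl.
apply: ler_sum => n _; apply: le_trans (cabs_sum_le _ _ _) _.
(* For fixed [n] the differences [k - n] with [k < m] are distinct and lie in [[-N, N)]. *)
have [k NE] : exists k, (2 * N = (N - n) + (m + k))%N.
  by exists (N + n - m)%N; have := ltn_ord n; lia.
rewrite NE !big_split_ord /=.
rewrite -[leLHS]add0r; apply: lerD; first by apply: sumr_ge0 => i _; exact: cabs_ge0.
rewrite -[leLHS]addr0; apply: lerD; last by apply: sumr_ge0 => i _; exact: cabs_ge0.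
apply: eq_ler; apply: eq_bigr => i _; congr (cabs (autocorr _ _ _)).
by have := ltn_ord n; lia.
Qed.

(** A unit shift adds one term and drops another, each of modulus at most [1]. *)
Lemma window_shift N m f (x : nat) : unimodular f ->
  cabs (window N m f 0) - 2 * x%:R <= cabs (window N m f x%:Z).
Proof.
move=> f1; elim: x => [|x IHx]; first by rewrite mulr0 subr0.
have E : window N m f x.+1%:Z + cutoff N f x%:Z =
    window N m f x%:Z + cutoff N f (x + m)%N%:Z.
  have := erefl (\sum_(n < m.+1) cutoff N f (x%:Z + n%:Z)).
  rewrite {1}big_ord_recl big_ord_recr /= addr0 PoszD => <-; rewrite addrC; congr (_ + _).
  by apply: eq_bigr => i _; congr cutoff; rewrite /bump /=; lia.
have -> : window N m f x.+1%:Z =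
    window N m f x%:Z + (cutoff N f (x + m)%N%:Z - cutoff N f x%:Z).
  by rewrite addrA -E addrK.
set w := window _ _ _ x%:Z in IHx *; set d := cutoff _ _ _ - cutoff _ _ _.
have d2 : cabs d <= 2.
  apply: le_trans (cabs_le_add _ _) _; rewrite cabsN.
  by have := cutoff_le1 N (x + m)%N%:Z f1; have := cutoff_le1 N x%:Z f1; lra.
have := cabs_le_add (w + d) (- d); rewrite addrK cabsN.
by rewrite -natr1; lra.
Qed.

(* Moving the window by [x <= T / 4] changes its sum by at most [T / 2]; the
   resulting exponent is worse than the optimal one, which is immaterial. *)
Lemma autocorr_lower N m f : unimodular f -> (0 < N)%N -> (m <= N)%N ->
  cabs (\sum_(n < m) f n) ^+ 3 / 16 <=
  m%:R * \sum_(a < 2 * N) cabs (autocorr N f (a%:Z - N%:Z)).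
Proof.
move=> f1 N0 lemN; apply: le_trans (window_energy _ lemN).
set T := cabs _.
have T0 : 0 <= T by exact: cabs_ge0.
have TE : cabs (window N m f 0) = T.
  congr cabs; apply: eq_bigr => n _; rewrite add0r /cutoff.
  by rewrite lez_nat ltz_nat (leq_trans (ltn_ord n)).
have Tm : T <= m%:R.
  apply: le_trans (cabs_sum_le _ _ _) _.
  by under eq_bigr do rewrite unimodularP //; rewrite sumr_const card_ord.
(* This counts the integers [x] with [0 <= x <= T / 4], so it exceeds [T / 4]; each contributes at
   least [(T / 2) ^+ 2]. *)
set K := (Num.truncn (T / 4)).+1.
have /andP [Kle Kgt] : (Num.truncn (T / 4))%:R <= T / 4 < K%:R.
  by apply: truncn_itv; rewrite divr_ge0.
have KN : (K <= N)%N.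
  rewrite /K -(ltr_nat R); apply: le_lt_trans Kle _.
  have : m%:R <= N%:R :> R by rewrite ler_nat.
  have : 0 < N%:R :> R by rewrite ltr0n.
  by lra.
have -> : (2 * N = N + (K + (N - K)))%N by lia.
rewrite !big_split_ord /= -[leLHS]add0r.
apply: lerD; first by apply: sumr_ge0 => i _; exact: sqr_ge0.
rewrite -[leLHS]addr0; apply: lerD; last by apply: sumr_ge0 => i _; exact: sqr_ge0.
apply: (@le_trans _ _ (\sum_(x < K) (T / 2) ^+ 2)).
  rewrite sumr_const card_ord -[leRHS]mulr_natl.
  have -> : T ^+ 3 / 16 = T / 4 * (T / 2) ^+ 2 by field.
  by rewrite ler_wpM2r ?sqr_ge0 // ltW.
apply: ler_sum => x _.
have -> : (N + x)%N%:Z - N%:Z = x%:Z by lia.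
rewrite lerXn2r ?nnegrE ?cabs_ge0 ?divr_ge0 //.
apply: le_trans (window_shift _ _ _ f1); rewrite TE.
have : x%:R <= T / 4; last by lra.
by apply: le_trans Kle; rewrite ler_nat -ltnS.
Qed.

(** Cauchy-Schwarz passes from the sum of autocorrelations to the sum of their squares. The
    denominator is [2 ^ 11 = 256 * 2 * 4], from the squared [16], the [2 * N] steps and the bound
    [4 * N ^ 3] for [card_Pi]. *)
Lemma gowers_pow2_ge N m f y : unimodular f -> (0 < N)%N -> (m <= N)%N ->
  cabs y = 1 ->
  (cabs (\sum_(n < m) f n * y ^+ n) / N%:R) ^+ 6 / 2 ^+ 11 <=
  complex.Re (gowers_pow 2 N f).
Proof.
move=> f1 N0 lemN y1.
have NR : 0 < N%:R :> R by rewrite ltr0n.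
set T := cabs _; have T0 : 0 <= T by exact: cabs_ge0.
have fy1 : unimodular (fun n => f n * y ^+ n).
  by move=> n; rewrite cabsE cabsM cabsX y1 expr1n mulr1 unimodularP.
have hT : T ^+ 3 / 16 <= N%:R * \sum_(a < 2 * N) cabs (autocorr N f (a%:Z - N%:Z)).
  apply: le_trans (autocorr_lower fy1 N0 lemN) _.
  under eq_bigr => a _ do rewrite autocorr_twist //.
  by rewrite ler_wpM2r ?ler_nat // sumr_ge0 // => i _; exact: cabs_ge0.
set B := \sum_(a < _) _ in hT.
have CS := sqr_sum_le (fun a : 'I_(2 * N) => cabs (autocorr N f (a%:Z - N%:Z))).
rewrite -/B in CS; set B2 := \sum_(a < _) _ in CS.
have B0 : 0 <= B by apply: sumr_ge0 => i _; exact: cabs_ge0.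
have c0 : 0 < (card_Pi 2 N)%:R :> R.
  rewrite ltr0n; have := card_Pi_ge 2 N0; have : (0 < N ^ 3)%N by rewrite expn_gt0 N0.
  by lia.
have cle : (card_Pi 2 N)%:R <= 4 * N%:R ^+ 3 :> R.
  have -> : 4 * N%:R ^+ 3 = (N * (2 * N) ^ 2)%:R :> R.
    by rewrite natrM natrX natrM; ring.
  by rewrite ler_nat card_Pi_le.
have -> : complex.Re (gowers_pow 2 N f) = B2 / (card_Pi 2 N)%:R.
  rewrite gowers_powE gsum2E -/B2 mulrC.
  by rewrite -(rmorph_nat (@real_complex R)) -fmorphV -rmorphM.
rewrite ler_pdivlMr //.
have T6 : T ^+ 6 / 256 <= 2 * N%:R ^+ 3 * B2.
  have : (T ^+ 3 / 16) ^+ 2 <= (N%:R * B) ^+ 2.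
    by rewrite lerXn2r ?nnegrE ?mulr_ge0 ?invr_ge0 ?exprn_ge0 // ltW.
  have -> : (T ^+ 3 / 16) ^+ 2 = T ^+ 6 / 256 by field.
  move=> /le_trans; apply; rewrite [leLHS](_ : _ = N%:R ^+ 2 * B ^+ 2); last by ring.
  have -> : 2 * N%:R ^+ 3 * B2 = N%:R ^+ 2 * ((2 * N)%:R * B2) by rewrite natrM; ring.
  by rewrite ler_wpM2l // exprn_ge0 // ltW.
set U := (T / N%:R) ^+ 6 / 2 ^+ 11.
have U0 : 0 <= U by rewrite mulr_ge0 ?invr_ge0 ?exprn_ge0 // mulr_ge0 ?invr_ge0 // ltW.
apply: le_trans (ler_wpM2l U0 cle) _.
have -> : U * (4 * N%:R ^+ 3) = T ^+ 6 / 256 / (2 * N%:R ^+ 3).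
  by rewrite /U; field; rewrite lt0r_neq0.
by rewrite ler_pdivrMr ?mulr_gt0 ?exprn_gt0 // [leRHS]mulrC.
Qed.

End LowerBound.

(** * Comparison of the two norms *)

(** The window misses [K] terms at the bottom and [L - K - m] at the top. If it overshoots [L],
    truncated subtraction gives [0] and the surplus terms are nonnegative. *)
Lemma sum_le_window (R : realType) (a : nat -> R) (A : R) (L K m : nat) :
  (forall t, 0 <= a t <= A) ->
  \sum_(t < L) a t <= \sum_(t < m) a (t + K)%N + A * (K + (L - K - m))%:R.
Proof.
move=> ha; have a0 t : 0 <= a t by case/andP: (ha t).
have aA t : a t <= A by case/andP: (ha t).
apply: (@le_trans _ _ (\sum_(t < K + (m + (L - K - m))) a t)).
  have [k ->] : exists k, (K + (m + (L - K - m)) = L + k)%N.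
    by exists (K + (m + (L - K - m)) - L)%N; lia.
  by rewrite big_split_ord /= lerDl sumr_ge0.
rewrite !big_split_ord /= addrCA natrD mulrDr; apply: lerD.
  by apply: eq_ler; apply: eq_bigr => i _; rewrite addnC.
by apply: lerD; rewrite mulr_natr -[X in _ *+ X]card_ord -sumr_const ler_sum.
Qed.

Section Assembly.
Variable R : realType.
Implicit Types f : nat -> R[i].

Lemma defect_bounds q s Ms f t : unimodular f ->
  0 <= defect q s Ms f t <= 2 * Ms%:R.
Proof.
move=> f1; rewrite /defect sumr_ge0 /= => [|i _]; last exact: cabs_ge0.
rewrite mulr_natr -[X in _ *+ X]card_ord -sumr_const ler_sum // => i _.
apply: cabs_1B_le2; apply: iter_mdiff_unim => n.
by rewrite /dilate unimodularP.
Qed.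

Lemma expR_half_le q n : (1 < q)%N -> ((q ^ n)%:R : R)^-1 <= expR (- (n%:R / 2)).
Proof.
move=> q1; rewrite expRN lef_pV2 ?posrE ?expR_gt0 ?ltr0n ?expn_gt0 ?(ltnW q1) //.
have e2 : expR (1 / 2 : R) <= 2.
  have := expR_ge1Dx (- (1 / 2) : R); rewrite expRN => h.
  have E0 : 0 < expR (1 / 2 : R) by exact: expR_gt0.
  by move: h; rewrite -(ler_pM2r E0) mulVf ?lt0r_neq0 //; lra.
rewrite natrX; elim: n => [|n IHn]; first by rewrite mul0r expR0.
rewrite exprS -natr1 (_ : (n%:R + 1) / 2 = 1 / 2 + n%:R / 2 :> R); last by field.
rewrite expRD; apply: ler_pM; rewrite ?expR_ge0 //.
by apply: le_trans e2 _; rewrite ler_nat.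
Qed.

Lemma gowers_pow_upper q s Ms : (1 < q)%N -> (0 < s)%N -> (0 < Ms)%N ->
  exists D c : R, [/\ 0 < D, 0 < c &
  forall f, unimodular f -> q_multiplicative q f -> forall N L, (q ^ L <= N)%N ->
    cabs (gowers_pow s N f) <=
      D * expR (- (c * \sum_(t < L) defect q s Ms f t ^+ 2))].
Proof.
move=> q1 s0 Ms0; pose K := s; pose J := (Ms + s)%N; pose B := (K + J)%N.
have q0 k : (0 < q ^ k)%N by rewrite expn_gt0 ltnW.
have sK : (s < q ^ K)%N by exact: ltn_expl.
have MJ : (Ms + s <= q ^ J)%N by apply: ltnW; exact: ltn_expl.
have B0 : 0 < B%:R :> R by rewrite ltr0n /B /K; lia.
pose c0 : R := (4 * (q ^ B)%:R ^+ s.+1 * Ms%:R ^+ 2)^-1 / B%:R.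
have c00 : 0 < c0.
  by rewrite divr_gt0 // invr_gt0 mulr_gt0 ?exprn_gt0 ?ltr0n // mulr_gt0 ?exprn_gt0 ?ltr0n.
pose A : R := (2 * Ms%:R) ^+ 2.
have A0 : 0 < A by rewrite exprn_gt0 // mulr_gt0 // ltr0n.
(* Pays for the digits the transfer bound does not see: the offset [K], and two blocks lost through
   rounding and through [j.-1]. *)
pose G := expR (c0 * (A * (K + 2 * B)%:R)).
(* The first value serves the boundary term, where [S / (4 * A)] is [x / 2]; the second reflects
   that half of [S] is kept. *)
pose c := Num.min (1 / (4 * A)) (c0 / 2).
pose D : R := s.+1%:R ^+ s.+1 * 2 ^+ s * 2 ^+ s.
have D0 : 0 < D by rewrite mulr_gt0 ?exprn_gt0 ?ltr0n // mulr_gt0 ?exprn_gt0 ?ltr0n.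
exists (D * (1 + G)), c; split.
- by rewrite mulr_gt0 // addr_gt0 // expR_gt0.
- by rewrite /c lt_min; apply/andP; split; rewrite divr_gt0 // mulr_gt0.
move=> f f1 fM N L leN; set S := \sum_(t < L) _.
have N0 : (0 < N)%N by apply: leq_trans leN.
have sb t : 0 <= defect q s Ms f t ^+ 2 <= A.
  have /andP [h0 h1] := defect_bounds q s Ms t f1.
  by rewrite sqr_ge0 lerXn2r ?nnegrE // mulr_ge0.
have S0 : 0 <= S by apply: sumr_ge0 => t _; case/andP: (sb t).
have SA : S <= A * L%:R.
  rewrite mulr_natr -[X in _ *+ X]card_ord -sumr_const ler_sum // => t _.
  by case/andP: (sb t).
(* Stopping [x] digits below the top makes the boundary term [q ^ (B * j) / N]
   exponentially small in [S] and still leaves half of [S] to the transfer. *)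
pose x := S / (2 * A).
have x0 : 0 <= x by rewrite divr_ge0 // mulr_ge0 // ltW.
have xA : x * A = S / 2 by rewrite /x; field; exact: lt0r_neq0.
have xL : x <= L%:R.
  rewrite -(ler_pM2r A0) xA; have := mulr_ge0 (ltW A0) (ler0n R L); lra.
pose j := Num.truncn ((L%:R - x) / B%:R).
have /andP [jle jgt] : j%:R <= (L%:R - x) / B%:R < j.+1%:R.
  by apply: truncn_itv; rewrite divr_ge0 ?subr_ge0 // ltW.
rewrite ler_pdivlMr // in jle; rewrite ltr_pdivrMr // in jgt.
have jL : (B * j <= L)%N by rewrite -(ler_nat R) natrM; lra.
have := @gowers_pow_le R s (q ^ (B * j)) N f
  (expR (- (c0 * \sum_(t < B * j.-1) defect q s Ms f (t + K)%N ^+ 2))) (q0 _) N0 f1.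
have fM' a b : (a < q ^ (B * j))%N ->
    f (a + q ^ (B * j) * b)%N = f a * f (q ^ (B * j) * b)%N.
  by move=> lta; rewrite (fM (B * j)%N) // dvdn_mulr.
move=> /(_ fM') H; apply: le_trans (H _ (expR_ge0 _)) _.
  move=> Psi Psi1; have := transfer_decay q1 s0 Ms0 sK MJ f1 fM j Psi1.
  by rewrite mulr1.
rewrite -[leRHS]mulrA -/D (ler_pM2l D0) [leRHS]mulrDl mul1r; apply: lerD.
  apply: (@le_trans _ _ ((q ^ (L - B * j))%:R^-1)).
    rewrite ler_pdivrMr ?ltr0n // mulrC ler_pdivlMr ?ltr0n // -natrM -expnD.
    by rewrite subnKC // ler_nat.
  apply: le_trans (expR_half_le _ q1) _; rewrite ler_expR lerN2.
  have cle : c <= 1 / (4 * A) by rewrite /c ge_min lexx.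
  apply: le_trans (ler_wpM2r S0 cle) _.
  have -> : 1 / (4 * A) * S = x / 2 by rewrite /x; field; exact: lt0r_neq0.
  by rewrite ler_wpM2r ?invr_ge0 // natrB // natrM; lra.
rewrite /G -expRD ler_expR.
have cle : c <= c0 / 2 by rewrite /c ge_min lexx orbT.
have cS := ler_wpM2r S0 cle.
have := @sum_le_window R (fun t => defect q s Ms f t ^+ 2) A L K (B * j.-1) sb.
rewrite -/S; set W := \sum_(t < B * j.-1) _ => hW.
have hr : (K + (L - K - B * j.-1))%:R <= (K + 2 * B)%:R + x.
  have h1 : ((L - K - B * j.-1) + B * j.-1 <= L)%N.
    have : (B * j.-1 <= L)%N by apply: leq_trans jL; rewrite leq_mul2l leq_pred orbT.
    by move: (B * j.-1)%N => m lemL; clear -lemL; lia.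
  have h2 : (B * j <= B * j.-1 + B)%N by case: j {jle jgt jL H fM' hW W h1} => [|j]; rewrite ?muln0 //= mulnS addnC.
  move: h1 h2; rewrite -!(ler_nat R) natrD (natrD _ (B * j.-1) B) !natrM => h1 h2.
  by rewrite (natrD _ K) (natrD _ K (2 * B)) natrM; move: jgt; rewrite -natr1; lra.
have hW2 : S / 2 <= W + A * (K + 2 * B)%:R.
  have := ler_wpM2l (ltW A0) hr; rewrite mulrDr [A * x]mulrC xA; lra.
have := ler_wpM2l (ltW c00) hW2; rewrite mulrDr; lra.
Qed.

Lemma gowers_pow2_lower q e : (1 < q)%N ->
  exists (Ms : nat) (a b : R), [/\ (0 < Ms)%N, 0 < a, 0 < b &
  forall f, unimodular f -> q_multiplicative q f ->
  forall N L, (q ^ L <= N < q ^ L.+1)%N ->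
    a * expR (- (b * \sum_(t < L) defect q e.+2 Ms f t ^+ 2)) <=
      complex.Re (gowers_pow 2 N f)].
Proof.
move=> q1; have [M' [C descent]] := degree_descent_to2 R e q q1.
have q0 k : (0 < q ^ k)%N by rewrite expn_gt0 ltnW.
have [C1 C10 C1E] : exists2 C1 : R, 0 <= C1 & C1 = 1000 * q%:R ^+ 13.
  by exists (1000 * q%:R ^+ 13); rewrite ?mulr_ge0 ?exprn_ge0 ?ler0n.
(* The successor and the [+ 1] ensure positivity. The sixth power is that of [gowers_pow2_ge], and
   dividing by [q] accounts for [N < q ^ L.+1]. *)
exists M'.+1, ((expR (- (C1 * (4 * e%:R))) / q%:R) ^+ 6 / 2 ^+ 11),
  (6 * C1 * C%:R ^+ 2 + 1); split => //.
- by rewrite divr_gt0 ?exprn_gt0 // divr_gt0 ?expR_gt0 // ltr0n ltnW.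
- by rewrite ltr_wpDl // !mulr_ge0 // exprn_ge0.
move=> f f1 fM N L /andP [leN ltN]; set S := \sum_(t < L) _.
have N0 : (0 < N)%N by apply: leq_trans leN.
pose sigma := defect q e.+2 M'.+1 f.
have sigma0 t : 0 <= sigma t by case/andP: (defect_bounds q e.+2 M'.+1 t f1).
have S0 : 0 <= S by apply: sumr_ge0 => t _; exact: sqr_ge0.
(* Levels below [e] cannot be reached by [e] descents and get the trivial bound [2]; they cost only
   the factor depending on [4 * e]. *)
pose eps t : R := if (t < e)%N then 2 else C%:R * sigma (t - e)%N.
have small t n : (n < q)%N ->
    cabs (1 - iter 2 (mdiff 1) (dilate (q ^ t) f) n) <= eps t.
  move=> ltn; rewrite /eps; case: ltnP => [_|let_].
    by apply: cabs_1B_le2; apply: iter_mdiff_unim => k; rewrite /dilate unimodularP.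
  have := descent f (t - e)%N (sigma (t - e)%N) f1 fM; rewrite subnK //; apply => // k ltk.
  rewrite /sigma /defect (bigD1 (Ordinal (ltnW ltk : (k < M'.+1)%N))) //= lerDl.
  by apply: sumr_ge0 => i _; exact: cabs_ge0.
have [y y1 hy] := fourier_lower q1 f1 fM small L.
apply: le_trans (gowers_pow2_ge f1 N0 leN y1).
have eps_sum : \sum_(t < L) eps t ^+ 2 <= 4 * e%:R + C%:R ^+ 2 * S.
  have [leL|ltL] := leqP L e.
    apply: (@le_trans _ _ (\sum_(t < L) 4)).
      apply: ler_sum => t _; rewrite /eps (leq_trans (ltn_ord t) leL); lra.
    rewrite sumr_const card_ord -[leLHS]mulr_natr.
    apply: (@le_trans _ _ (4 * e%:R)); first by rewrite ler_wpM2l // ler_nat.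
    by rewrite lerDl mulr_ge0 // exprn_ge0.
  have [k LE] : exists k, L = (e + k)%N by exists (L - e)%N; lia.
  rewrite /S LE big_split_ord /=; apply: lerD.
    rewrite mulr_natr -[X in _ *+ X]card_ord -sumr_const; apply: ler_sum => t _.
    by rewrite /eps ltn_ord; lra.
  rewrite (_ : \sum_(t < e + k) defect q e.+2 M'.+1 f t ^+ 2 =
    \sum_(t < k + e) sigma t ^+ 2); last by rewrite addnC.
  rewrite big_split_ord /= mulrDr.
  rewrite -[leLHS]addr0; apply: lerD; last first.
    by rewrite mulr_ge0 ?exprn_ge0 // sumr_ge0 // => t _; exact: sqr_ge0.
  rewrite big_distrr; apply: ler_sum => t _ /=.
  by rewrite /eps ltnNge leq_addr /= addKn exprMn.
rewrite -C1E in hy.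
set T := cabs _ in hy *.
have qL0 : 0 < (q ^ L)%:R :> R by rewrite ltr0n.
have NR : 0 < N%:R :> R by rewrite ltr0n.
have qR : 0 < q%:R :> R by rewrite ltr0n ltnW.
have TN : expR (- (C1 * (4 * e%:R + C%:R ^+ 2 * S))) / q%:R <= T / N%:R.
  rewrite ler_pdivlMr // mulrAC ler_pdivrMr //.
  apply: (@le_trans _ _ ((q ^ L)%:R * expR (- (C1 * \sum_(t < L) eps t ^+ 2)) * q%:R)); last first.
    by rewrite ler_wpM2r // ltW.
  rewrite [leLHS]mulrC [leRHS]mulrAC; apply: ler_pM; rewrite ?expR_ge0 //.
    by rewrite -natrM -expnSr ler_nat ltnW.
  by rewrite ler_expR lerN2 ler_wpM2l.
apply: (@le_trans _ _ ((expR (- (C1 * (4 * e%:R + C%:R ^+ 2 * S))) / q%:R) ^+ 6 / 2 ^+ 11)); last first.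
  rewrite ler_wpM2r ?invr_ge0 ?exprn_ge0 // lerXn2r ?nnegrE ?mulr_ge0 ?invr_ge0 //.
  exact: cabs_ge0.
have -> : expR (- (C1 * (4 * e%:R + C%:R ^+ 2 * S))) =
    expR (- (C1 * (4 * e%:R))) * expR (- (C1 * C%:R ^+ 2 * S)).
  by rewrite -expRD; congr expR; ring.
set E1 := expR (- (C1 * _)); set E2 := expR (- (C1 * C%:R ^+ 2 * S)).
have -> : (E1 * E2 / q%:R) ^+ 6 / 2 ^+ 11 = (E1 / q%:R) ^+ 6 / 2 ^+ 11 * E2 ^+ 6.
  by field; exact: lt0r_neq0.
rewrite ler_wpM2l //.
  by rewrite mulr_ge0 ?invr_ge0 ?exprn_ge0 // mulr_ge0 ?expR_ge0 // invr_ge0 ltW.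
rewrite /E2 -expRM_natl ler_expR.
have : 0 <= C%:R ^+ 2 * S by rewrite mulr_ge0 // exprn_ge0.
lra.
Qed.

(** Eliminates [S]: after taking the roots, [kappa] is the quotient of the two decay rates, so the
    exponentials agree and only the constants remain. *)
Lemma powR_compare (s : nat) (D c a b : R) : 0 < D -> 0 < c -> 0 < a -> 0 < b ->
  exists kappa C : R, [/\ 0 < kappa, 0 < C &
  forall S u v : R, 0 <= S -> 0 <= u <= D * expR (- (c * S)) ->
    a * expR (- (b * S)) <= v ->
    powR u (2 ^+ s)^-1 <= C * powR (powR v (2 ^+ 2)^-1) kappa].
Proof.
move=> D0 c0 a0 b0; set p := (2 ^+ s)^-1; set p2 := (2 ^+ 2)^-1 : R.
have p0 : 0 < p by rewrite invr_gt0 exprn_gt0.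
have p20 : 0 < p2 by rewrite invr_gt0 exprn_gt0.
pose kappa := c * p / (b * p2).
have k0 : 0 < kappa by rewrite divr_gt0 // mulr_gt0.
have ak : 0 < powR a (p2 * kappa) by exact: powR_gt0.
exists kappa, (powR D p / powR a (p2 * kappa)); split => //.
  by rewrite divr_gt0 // powR_gt0.
move=> S u v S0 /andP [u0 uD] va.
rewrite -powRrM.
have v0 : 0 <= v by apply: le_trans va; rewrite mulr_ge0 ?expR_ge0 // ltW.
apply: (@le_trans _ _ (powR (D * expR (- (c * S))) p)).
  by apply: ge0_ler_powR; rewrite ?nnegrE ?(ltW p0) // (le_trans u0).
have h : powR (a * expR (- (b * S))) (p2 * kappa) <= powR v (p2 * kappa).
  apply: ge0_ler_powR; rewrite ?nnegrE //; first by rewrite ltW // mulr_gt0.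
  by rewrite mulr_ge0 ?expR_ge0 // ltW.
rewrite powRM ?expR_ge0 ?(ltW a0) // -expRM in h.
rewrite powRM ?expR_ge0 ?(ltW D0) // -expRM -mulrA.
rewrite ler_wpM2l ?powR_ge0 // ler_pdivlMl //.
have -> : - (c * S) * p = - (b * S) * (p2 * kappa).
  by rewrite /kappa; field; rewrite !lt0r_neq0.
exact: h.
Qed.

(* [powR] of a negative base is [1], so monotonicity of the root needs this. *)
Lemma Re_gowers_pow_ge0 s N f : (0 < s)%N -> 0 <= complex.Re (gowers_pow s N f).
Proof.
case: s => // s _; rewrite gowers_powE gsum_square; last exact: cutoff_supported.
rewrite -(rmorph_nat (@real_complex R)) -fmorphV -rmorphM /=.
by rewrite mulr_ge0 ?invr_ge0 // sumr_ge0 // => h _; exact: sqr_ge0.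
Qed.

End Assembly.

Unset Implicit Arguments.

Theorem theoremB (R : realType) (q : nat) (hq : (2 <= q)%N) (s : nat) (hs : (2 <= s)%N) :
  exists (kappa C : R), 0 < kappa /\ 0 < C /\
    forall f : nat -> R[i], unimodular f -> q_multiplicative q f ->
    forall N : nat, (1 <= N)%N ->
      gowers_norm s N f <= C * powR (gowers_norm 2 N f) kappa.
Proof.
case: s hs => // -[//|e] _.
(* The descent in the lower bound dictates how many differences [Ms] must be controlled; the upper
   bound accepts any positive number, so both involve the same defects. *)
have [Ms [a [b [Ms0 a0 b0 lower]]]] := @gowers_pow2_lower R q e hq.
have [D [c [D0 c0 upper]]] := @gowers_pow_upper R q e.+2 Ms hq isT Ms0.
have [kappa [C [k0 C0 compare]]] := powR_compare e.+2 D0 c0 a0 b0.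
exists kappa, C; split=> //; split=> // f f1 fM N N0.
(* The number of digits [L] is the integer part of the base [q] logarithm of [N]. *)
have bounds := trunc_log_bounds hq N0.
have /andP [leN _] := bounds.
apply: compare (lower f f1 fM N _ bounds).
  by apply: sumr_ge0 => t _; exact: sqr_ge0.
rewrite Re_gowers_pow_ge0 //=.
exact: le_trans (Re_le_cabs _) (upper f f1 fM N _ leN).
Qed.
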